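(* Fix $k\in\{1,2,3,4\}$. For each $n$ let $f^0=f^0_n\in\mathbb{R}^n$ and $Y\sim\mathcal{N}_n(f^0,I)$, and choose $S=S_n\subseteq[k+1:n]$, $s=|S|$, such that $$\min_{i\in[1:s+1]}n_i\asymp n_{\max}$$ as $n\to\infty$, and such that $n_i\ge k(k+2)$ for all $i\in[1:s+1]$. Then one can choose $\lambda=\lambda_n$ of order $$\lambda\asymp n^{k-1}\Bigl(\frac{1}{s+1}\Bigr)^{\frac{2k-1}{2}}\sqrt{\frac{\log n}{n}}$$ such that with this choice, for all $f=f_n\in\mathbb{R}^n$, $$\|\hat f-f^0\|_n^2\le\|f-f^0\|_n^2+4\lambda\|(\Delta(k)f)_{-S}\|_1+\mathcal{O}_{\mathbb{P}}\Bigl(\frac{s+1}{n}\log\bigl(n/(s+1)\bigr)\log n\Bigr).$$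
   Context: Notation: $[a:b]=\{j\in\mathbb{N}: a\le j\le b\}$; for $v\in\mathbb{R}^n$, $\|v\|_n^2:=\frac1n\sum_{i=1}^n v_i^2$. For $k\in[1:n-1]$, the $k$-th order difference operator $\Delta(k)\in\mathbb{R}^{(n-k)\times n}$ has rows indexed by $\mathcal{D}=[k+1:n]$ and columns indexed by $[1:n]$, with $\Delta(k)_{ij}=(-1)^l\binom{k}{l}$ if $j=i-l$ with $l\in[0:k]$, $i\in\mathcal{D}$, and $\Delta(k)_{ij}=0$ otherwise. The estimator is $\hat f:=\arg\min_{g\in\mathbb{R}^n}\{\|Y-g\|_n^2+2\lambda\|\Delta(k)g\|_1\}$. For $S=\{t_1<\cdots<t_s\}\subseteq\mathcal{D}$, put $t_0:=k$, $t_{s+1}:=n+1$, $n_i:=t_i-t_{i-1}$ for $i\in[1:s+1]$, $n_{\max}:=\max_{1\le i\le s+1}n_i$, and $(\Delta(k)f)_{-S}:=\{(\Delta(k)f)_j: j\in\mathcal{D}\setminus S\}$. Asymptotics are as $n\to\infty$. For sequences $a_n,b_n\in(0,\infty)$: $a_n=\mathcal{O}(b_n)$ if $\limsup_n a_n/b_n<\infty$, and $a_n\asymp b_n$ if also $b_n=\mathcal{O}(a_n)$. For random variables, $Z_n=\mathcal{O}_{\mathbb{P}}(1)$ if $\lim_{M\to\infty}\limsup_{n\to\infty}\mathbb{P}(|Z_n|>M)=0$; a term $\mathcal{O}_{\mathbb{P}}(r_n)$ on the right-hand side denotes some random variable $R_n$ with $R_n/r_n=\mathcal{O}_{\mathbb{P}}(1)$.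 *)

(* Defs.v *)
From HB Require Import structures.
From mathcomp Require Import all_boot all_order all_algebra.
From mathcomp Require Import all_classical all_reals all_analysis.
Set Implicit Arguments.
Unset Strict Implicit.
Unset Printing Implicit Defensive.
Import Order.TTheory GRing.Theory Num.Theory.
Import numFieldNormedType.Exports.
Local Open Scope classical_set_scope.
Local Open Scope ring_scope.

Definition sqnorm_n (R : realType) (n : nat) (v : 'cV[R]_n) : R :=
  n%:R^-1 * \sum_(i < n) v i 0 ^+ 2.

Definition norm1 (R : realType) (m : nat) (v : 'cV[R]_m) : R :=
  \sum_(i < m) `|v i 0|.

(* The 0-based indices r : 'I_(n - k) and c : 'I_n stand for the 1-based row
   i = k + r + 1 in [k+1:n] and column j = c + 1 in [1:n]; l = i - j. *)
Definition Delta (R : realType) (k n : nat) : 'M[R]_(n - k, n) :=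
  \matrix_(r < n - k, c < n)
    let i := (k + r).+1 in
    let j := c.+1 in
    if (j <= i <= j + k)%N then (-1) ^+ (i - j) * 'C(k, i - j)%:R else 0.

Definition objective (R : realType) (k n : nat) (lambda : R)
    (y g : 'cV[R]_n) : R :=
  sqnorm_n (y - g) + 2 * lambda * norm1 (Delta R k n *m g).

(* The objective has a unique minimiser for lambda >= 0 and n > 0, so the
   choice made by [xget] is immaterial. *)
Definition estimator (R : realType) (k n : nat) (lambda : R)
    (y : 'cV[R]_n) : 'cV[R]_n :=
  xget 0 [set g : 'cV[R]_n |
    forall h : 'cV[R]_n, objective k lambda y g <= objective k lambda y h].

(* S is a set of row indices of [Delta R k n]: r in S stands for the element
   k + r + 1 of [k+1:n].  [enum] lists S increasingly, so [knots S] is the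
   sequence t_0 = k, t_1 < ... < t_s, t_(s+1) = n + 1. *)
Definition knots (k n : nat) (S : {set 'I_(n - k)}) : seq nat :=
  k :: rcons [seq (k + nat_of_ord r).+1 | r <- enum S] n.+1.

(* n_i = t_i - t_(i-1), meaningful for 1 <= i <= s + 1. *)
Definition gap (k n : nat) (S : {set 'I_(n - k)}) (i : nat) : nat :=
  (nth 0 (knots S) i - nth 0 (knots S) i.-1)%N.

Definition gap_max (k n : nat) (S : {set 'I_(n - k)}) : nat :=
  \max_(1 <= i < #|S|.+2) gap S i.

(* The unit [gap S 1] is itself one of the values being minimised. *)
Definition gap_min (k n : nat) (S : {set 'I_(n - k)}) : nat :=
  \big[minn/gap S 1]_(1 <= i < #|S|.+2) gap S i.

Definition norm1_off (R : realType) (k n : nat) (S : {set 'I_(n - k)})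
    (f : 'cV[R]_n) : R :=
  \sum_(j < n - k | j \notin S) `|(Delta R k n *m f) j 0|.

(* For sequences that are eventually positive. *)
Definition bigO_seq (R : realType) (a b : nat -> R) : Prop :=
  (limn_esup (fun n => (a n / b n)%:E) < +oo)%E.

Definition asymp (R : realType) (a b : nat -> R) : Prop :=
  bigO_seq a b /\ bigO_seq b a.

(* Each Z n may live on its own probability space. *)
Definition bounded_in_probability (R : realType) (d : nat -> measure_display)
    (T : forall n : nat, measurableType (d n))
    (P : forall n : nat, probability (T n) R)
    (Z : forall n : nat, T n -> R) : Prop :=
  limn_esup (fun n => P n [set w | M < `|Z n w|]) @[M --> +oo%R] --> (0 : \bar R).

Definition mutually_independent (R : realType) (d : measure_display)
    (T : measurableType d) (P : probability T R) (n : nat)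
    (X : 'I_n -> {RV P >-> R}) : Prop :=
  forall (J : {set 'I_n}) (A : 'I_n -> set R),
    (forall i, measurable (A i)) ->
    P (\bigcap_(i in [set` J]) (X i @^-1` A i))
      = (\prod_(i in J) P (X i @^-1` A i))%E.

(* The random vector (X_0, ..., X_(n-1)) has law N_n(mu, I): independent
   coordinates, the i-th one normal with mean mu_i and variance 1. *)
Definition std_gaussian_vector (R : realType) (d : measure_display)
    (T : measurableType d) (P : probability T R) (n : nat)
    (X : 'I_n -> {RV P >-> R}) (mu : 'cV[R]_n) : Prop :=
  mutually_independent X /\
  forall (i : 'I_n) (A : set R), measurable A ->
    P (X i @^-1` A) = normal_prob (mu i 0) 1 A.

Definition observation (R : realType) (d : measure_display)
    (T : measurableType d) (P : probability T R) (n : nat)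
    (X : 'I_n -> {RV P >-> R}) (w : T) : 'cV[R]_n :=
  \col_i X i w.

Definition lambda_order (R : realType) (k n s : nat) : R :=
  n%:R ^+ k.-1 * (1 / s.+1%:R) `^ ((2 * k%:R - 1) / 2)
    * Num.sqrt (ln n%:R / n%:R).

Definition remainder_order (R : realType) (n s : nat) : R :=
  s.+1%:R / n%:R * ln (n%:R / s.+1%:R) * ln n%:R.

(* Main.v *)
Require Import Defs.
From HB Require Import structures.
From mathcomp Require Import all_boot all_order all_algebra.
From mathcomp Require Import all_classical all_reals all_analysis.
From mathcomp Require Import measurable_realfun ring lra zify.
Set Implicit Arguments.
Unset Strict Implicit.
Unset Printing Implicit Defensive.
Import Order.TTheory GRing.Theory Num.Theory.
Import numFieldNormedType.Exports.
Local Open Scope classical_set_scope.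
Local Open Scope ring_scope.

(** Write D for the k-th order difference matrix, e for the noise Y - f0, and
    h for the estimator minus f.  Strong convexity of the objective
    ([basic_inequality]) and the triangle inequality reduce the theorem to a
    bound, uniform in h, on

      (2/n) <e, h> + 2 lambda (|(D h)_S|_1 - |(D h)_-S|_1) - |h|^2 / (2 n).

    The noise is split as <e, h> = <Q e, h> + sum_r w_r (D h)_r, where w
    vanishes at the knots and at the k - 1 rows after each knot, and Q projects
    orthogonally onto the vectors whose differences vanish at all other rows, a
    space of dimension at most k (s + 1) ([noise_splitting]).  The variance of
    w_r is the least squared norm of a vector c with (D c)_r = 1 and zero
    differences at the other free rows.  A truncated power cut at a knot t is
    such a c, so the variance is at most |r - t|^(2k-1) for every knot t.

    The signs of D h at the knots are interpolated by a vector q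
    ([interpolating_vector]).  As soon as |w_r| <= n lambda (1 - |q_r|) off S,
    the expression above is at most
    (4/n) |Q e|^2 + 4 n lambda^2 |D^T q|^2 ([noise_penalty_bound]).
    So away from the knots 1 - |q| must be at least of order
    (distance / gap)^(k-1/2), to dominate the noise, while the k-th differences
    of q have to be small in l^2.  Both are achieved by mixing, over
    the dyadic scales 4^l, ramps obtained by averaging a jump k times over
    windows of length 4^l, with weights proportional to 2^(l(2k-1)).  The
    differences of order k of the l-th ramp live on k 4^l points and are at most
    (2 / 4^l)^k, hence each scale contributes equally to the squared norm of the
    differences, whence |D^T q|^2 = O(s gap^-(2k-1) log gap) ([hat_energy]).

    Finally, n lambda is of order gap^(k-1/2) sqrt(log n), which dominates the
    Gaussian fluctuations of all the w_r at once, and both remainder terms are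
    O((s+1)/n log(n/(s+1)) log n) ([fast_rate_calibrated]).  The only
    probabilistic input is a union bound for at most 2n linear forms in e
    ([gaussian_sq_union_bound]).  On the exceptional event, of probability at
    most 4/n, the remainder is a crude random bound, which affects neither
    its measurability nor its boundedness in probability
    ([remainder_variable]). *)

(** * Expectations of products of independent variables *)

Section independence.
Local Open Scope ereal_scope.
Import HBNNSimple.

(** The hypothesis says that the image under X of the measure with density H
    is c nu; the conclusion transfers this from indicators to nonnegative
    functions by approximation with simple functions.  It serves to factor one
    variable out of an expectation, to integrate against the law of a variable,
    and to integrate against a density. *)
Lemma integral_weighted_pushforward (R : realType) (d d' : measure_display)
    (T : measurableType d) (U : measurableType d')
    (mu : {measure set T -> \bar R}) (nu : {measure set U -> \bar R})
    (X : T -> U) (H : T -> R) (c : R) :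
  measurable_fun setT X ->
  measurable_fun setT H -> (forall x, (0 <= H x)%R) ->
  (forall A : set U, measurable A ->
     \int[mu]_x (H x * \1_(X @^-1` A) x)%:E = c%:E * nu A) ->
  forall g : U -> R, measurable_fun setT g -> (forall x, 0 <= g x)%R ->
  \int[mu]_x (H x * g (X x))%:E = c%:E * \int[nu]_y (g y)%:E.
Proof.
move=> mX mH H0 dec g mg g0.
have mXA A : measurable A -> measurable (X @^-1` A).
  by move=> mA; rewrite -[X in measurable X]setTI; exact: mX.
have mEg : measurable_fun setT (EFin \o g) by exact/measurable_EFinP.
pose h := nnsfun_approx measurableT mEg.
have hcvg y : (h n y)%:E @[n --> \oo] --> (g y)%:E.
  by apply: (cvg_nnsfun_approx measurableT mEg) => // x _; rewrite lee_fin.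
have hnd y : {homo (fun n => h n y) : m n / (m <= n)%N >-> (m <= n)%R}.
  by move=> m n mn; exact/lefP/nd_nnsfun_approx.
have mhX n : measurable_fun setT (fun t => h n (X t)).
  by apply: measurableT_comp.
have E1 : \int[nu]_y (h n y)%:E @[n --> \oo] --> \int[nu]_y (g y)%:E.
  have -> : \int[nu]_y (g y)%:E = \int[nu]_y limn (fun n => (h n y)%:E).
    by apply: eq_integral => t _; apply/esym/cvg_lim.
  apply: cvg_monotone_convergence => //.
  - by move=> n; apply/measurable_EFinP.
  - by move=> n x _; rewrite lee_fin.
  - by move=> t _ m n mn; rewrite lee_fin hnd.
have E2 : \int[mu]_x (H x * h n (X x))%:E @[n --> \oo] -->
    \int[mu]_x (H x * g (X x))%:E.
  have -> : \int[mu]_x (H x * g (X x))%:E =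
      \int[mu]_x limn (fun n => (H x * h n (X x))%:E).
    apply: eq_integral => t _; apply/esym/cvg_lim => //.
    under eq_fun do rewrite EFinM.
    by rewrite EFinM; apply: cvgeZl.
  apply: cvg_monotone_convergence => //.
  - by move=> n; apply/measurable_EFinP; apply: measurable_funM.
  - by move=> n x _; rewrite lee_fin mulr_ge0.
  - by move=> t _ m n mn; rewrite lee_fin ler_wpM2l// hnd.
suff E n : \int[mu]_x (H x * h n (X x))%:E = c%:E * \int[nu]_y (h n y)%:E.
  have E3 : \int[mu]_x (H x * h n (X x))%:E @[n --> \oo] -->
      c%:E * \int[nu]_y (g y)%:E.
    by under eq_fun do rewrite E; apply: cvgeZl.
  by move/cvg_lim : E2 => <- //; move/cvg_lim : E3 => <-.
pose Z y : set U := h n @^-1` [set y].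
have mZ r : measurable (Z r) by exact: measurable_sfunP.
have hE x : (h n x)%:E = \sum_(y \in range (h n)) (y * \1_(Z y) x)%:E.
  by rewrite fimfunE -fsumEFin.
have ge0y y x : 0 <= (y * \1_(Z y) x)%:E by exact: nnfun_muleindic_ge0.
have mInd y : measurable_fun setT (fun x => y * \1_(Z y) x)%R.
  by apply: measurable_funM.
have mIndX y : measurable_fun setT (fun x => y * \1_(Z y) (X x))%R.
  exact: (measurableT_comp (mInd y)).
have HhE x : (H x * h n (X x))%:E =
    \sum_(y \in range (h n)) (H x * (y * \1_(Z y) (X x)))%:E.
  by rewrite EFinM hE ge0_mule_fsumr.
under eq_integral do rewrite HhE.
rewrite ge0_integral_fsum//; last 2 first.
- by move=> y; apply/measurable_EFinP/measurable_funM.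
- by move=> y x _; rewrite EFinM mule_ge0// lee_fin.
under [in RHS]eq_integral do rewrite hE.
rewrite ge0_integral_fsum//; last first.
- by move=> y; exact/measurable_EFinP.
rewrite ge0_mule_fsumr; last by move=> y; apply: integral_ge0.
apply: eq_fsbigr => y; rewrite inE => -[z _ zy].
have y0 : (0 <= y)%R by rewrite -zy.
rewrite (_ : (fun x => _) =
    (fun x => y%:E * (H x * \1_(X @^-1` Z y) x)%:E)); last first.
  by apply/funext => x; rewrite -EFinM mulrCA.
rewrite ge0_integralZl_EFin//; last 2 first.
- by move=> x _; rewrite lee_fin mulr_ge0.
- apply/measurable_EFinP/measurable_funM => //; apply: measurable_indic.
  exact: mXA.
rewrite dec//; under [in RHS]eq_integral do rewrite EFinM.
rewrite ge0_integralZl_EFin//; last exact/measurable_EFinP.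
by rewrite integral_indic// setIT muleCA.
Qed.

(** Independence is known for events, that is, when every factor is an
    indicator.  The indicators are replaced by the functions [g i] one index at
    a time; when index m is treated, the other factors form the density H of
    [integral_weighted_pushforward]. *)
Lemma integral_prod_independent (R : realType) (d : measure_display)
    (T : measurableType d) (P : probability T R) (n : nat)
    (X : 'I_n -> {RV P >-> R}) (g : 'I_n -> R -> R) (e : 'I_n -> R) :
  mutually_independent X ->
  (forall i, measurable_fun setT (g i)) -> (forall i x, (0 <= g i x)%R) ->
  (forall i, \int[P]_w (g i (X i w))%:E = (e i)%:E) ->
  \int[P]_w (\prod_i g i (X i w))%:E = (\prod_i e i)%:E.
Proof.
move=> indep mg g0 ge.
(* the first m factors are already general functions, the others still are
   indicators *)
pose G m (A : 'I_n -> set R) (i : 'I_n) : R -> R :=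
  if (i < m)%N then g i else \1_(A i).
pose E m (A : 'I_n -> set R) (i : 'I_n) :=
  if (i < m)%N then e i else fine (P (X i @^-1` A i)).
have mX i : measurable_fun setT (X i) by exact: measurable_funP.
have mXA i A : measurable A -> measurable (X i @^-1` A).
  by move=> mA; rewrite -[Y in measurable Y]setTI; exact: mX.
have PE i A : measurable A -> P (X i @^-1` A) = (fine (P (X i @^-1` A)))%:E.
  by move=> mA; rewrite fineK// fin_num_measure//; exact: mXA.
have mG m A i : measurable (A i) -> measurable_fun setT (G m A i).
  by move=> mA; rewrite /G; case: ifP.
have G0 m A i x : (0 <= G m A i x)%R by rewrite /G; case: ifP.
suff claim m A : (m <= n)%N -> (forall i, measurable (A i)) ->
    \int[P]_w (\prod_i G m A i (X i w))%:E = (\prod_i E m A i)%:E.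
  have := claim n (fun=> setT) (leqnn n) (fun=> measurableT).
  under eq_bigr do rewrite /E ltn_ord.
  move=> <-; apply: eq_integral => w _.
  by congr (_%:E); apply: eq_bigr => i _; rewrite /G ltn_ord.
elim: m A => [|m IH] A mn mA.
  have := indep [set: 'I_n]%SET A mA.
  rewrite (_ : (\prod_(i in _) _) = (\prod_i E 0 A i)%:E); last first.
    rewrite -prodEFin; apply: eq_big => i; first by rewrite inE.
    by move=> _; rewrite /E ltn0 -PE.
  set B := (X in P X); move=> <-.
  have mB : measurable B.
    by apply: fin_bigcap_measurable => // i _; exact: mXA.
  rewrite -[B]setIT -integral_indic//.
  apply: eq_integral => w _; congr (_%:E); rewrite indicE.
  have [wA|wA] := boolP (w \in _).
    rewrite big1// => i _; rewrite /G ltn0 indicE.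
    by move: wA; rewrite inE => /(_ i); rewrite /= inE => /(_ isT) ?; rewrite mem_set.
  apply/eqP; rewrite prodf_seq_eq0; apply/hasP.
  move: wA; rewrite notin_setE => /existsNP[i /not_implyP[_ wAi]].
  exists i; first by rewrite mem_index_enum.
  by rewrite /= /G ltn0 indicE memNset.
pose i0 := Ordinal mn.
have mi i : i != i0 -> (i < m.+1)%N = (i < m)%N.
  by move=> ii0; rewrite ltnS leq_eqVlt -[m]/(nat_of_ord i0) val_eqE (negbTE ii0).
pose H w := (\prod_(i | i != i0) G m A i (X i w))%R.
pose c := (\prod_(i | i != i0) E m A i)%R.
have -> : (\prod_i E m.+1 A i = c * e i0)%R.
  rewrite (bigD1 i0)//= {1}/E ltnS leqnn mulrC; congr (_ * _)%R.
  by apply: eq_bigr => i ii0; rewrite /E mi.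
under eq_integral => w _.
  rewrite (bigD1 i0)//= {1}/G ltnS leqnn mulrC.
  under eq_bigr => i ii0 do rewrite /G mi// -/(G m A i).
  rewrite -/(H w).
  over.
rewrite (@integral_weighted_pushforward _ _ _ _ _ P (pushforward P (X i0))
  (X i0) H c)//.
- rewrite ge0_integral_pushforward//; last 2 first.
  + exact/measurable_EFinP.
  + by move=> y _; rewrite lee_fin.
  by rewrite preimage_setT ge -EFinM.
- rewrite /H (_ : (fun w => _) = fun w =>
    \prod_i if i != i0 then G m A i (X i w) else 1)%R; last first.
    by apply/funext => w; rewrite big_mkcond.
  apply: measurable_prod => i _; case: (i != i0) => //.
  by apply: measurableT_comp => //; exact: mG.
- by move=> w; apply: prodr_ge0.
move=> B mB; pose A' i := if i == i0 then B else A i.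
have mA' i : measurable (A' i) by rewrite /A'; case: ifP.
have EA : (\prod_i E m A' i = c * fine (P (X i0 @^-1` B)))%R.
  rewrite (bigD1 i0)//= mulrC; congr (_ * _)%R.
    by apply: eq_bigr => i ii0; rewrite /E /A' (negbTE ii0).
  by rewrite /E ltnn /A' eqxx.
transitivity (c%:E * (fine (P (X i0 @^-1` B)))%:E); last first.
  by congr (_ * _); exact/esym/PE.
rewrite -EFinM -EA -(IH A' (ltnW mn) mA').
apply: eq_integral => w _; congr (_%:E).
rewrite [RHS](bigD1 i0)//= mulrC; congr (_ * _)%R.
  by rewrite /G ltnn /A' eqxx.
by apply: eq_bigr => i ii0; rewrite /G /A' (negbTE ii0).
Qed.

End independence.

(** * Gaussian tails *)

Section gaussian.
Local Open Scope ereal_scope.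
Context {R : realType} {d : measure_display} {T : measurableType d}.
Context (P : probability T R).

(** Completing the square: tilting the normal density by an exponential
    translates its mean. *)
Lemma expR_mul_normal_pdf (m t x : R) :
  (expR (t * (x - m)) * normal_pdf m 1 x =
   expR (t ^+ 2 / 2) * normal_pdf (m + t) 1 x)%R.
Proof.
rewrite !normal_pdfE ?oner_eq0// mulrCA [RHS]mulrCA; congr (_ * _)%R.
rewrite /normal_fun -!expRD; congr expR.
by field.
Qed.

Lemma normal_mgf (X : {RV P >-> R}) (m t : R) :
  (forall A : set R, measurable A -> P (X @^-1` A) = normal_prob m 1 A) ->
  \int[P]_w (expR (t * (X w - m)))%:E = (expR (t ^+ 2 / 2))%:E.
Proof.
move=> lawX.
have mX : measurable_fun setT X by exact: measurable_funP.
pose g (x : R) := expR (t * (x - m)).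
have mg : measurable_fun setT g.
  apply: measurableT_comp => //.
  by apply: measurable_funM => //; apply: measurable_funB.
have g0 x : (0 <= g x)%R by exact: expR_ge0.
transitivity (\int[normal_prob m 1]_x (g x)%:E).
  have := @integral_weighted_pushforward R _ _ _ _ P (normal_prob m 1) X
    (fun=> 1%R) 1 mX _ _ _ g mg g0.
  rewrite mul1e => <-//.
  - by apply: eq_integral => w _; rewrite mul1r.
  - move=> A mA; under eq_integral do rewrite mul1r.
    rewrite integral_indic// ?setIT ?mul1e; first exact: lawX.
    by rewrite -[Y in measurable Y]setTI; exact: mX.
have := @integral_weighted_pushforward R _ _ _ _ lebesgue_measure
  (normal_prob m 1) id (normal_pdf m 1) 1 _ _ _ _ g mg g0.
rewrite mul1e => <-//=.
- under eq_integral do rewrite mulrC expR_mul_normal_pdf EFinM.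
  rewrite ge0_integralZl_EFin ?expR_ge0//.
  + by rewrite integral_normal_pdf mule1.
  + by move=> x _; rewrite lee_fin normal_pdf_ge0.
  + by apply/measurable_EFinP; exact: measurable_normal_pdf.
- exact: measurable_normal_pdf.
- by move=> x; exact: normal_pdf_ge0.
- move=> A mA; rewrite mul1e /normal_prob [RHS]integral_mkcond.
  apply: eq_integral => x _; rewrite patchE indicE.
  by case: ifP => xA; rewrite ?mulr1 ?mulr0.
Qed.

(** Chernoff bound; the threshold t v makes t itself the optimal exponent. *)
Lemma gaussian_tail (n : nat) (X : 'I_n -> {RV P >-> R}) (mu : 'cV[R]_n)
    (a : 'I_n -> R) (v t : R) :
  std_gaussian_vector X mu -> (0 < v)%R -> (\sum_i a i ^+ 2 = v)%R -> (0 < t)%R ->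
  P [set w | (t * v <= \sum_i a i * (X i w - mu i ord0))%R] <=
    (expR (- (t ^+ 2 * v / 2)))%:E.
Proof.
move=> [indep law] v0 sumv t0.
have mX i : measurable_fun setT (X i) by exact: measurable_funP.
have mW : measurable_fun setT (fun w => \sum_i a i * (X i w - mu i ord0))%R.
  by apply: measurable_sum => i; apply: measurable_funM => //; apply: measurable_funB.
pose W : {RV P >-> R} := HB.pack (fun w => \sum_i a i * (X i w - mu i ord0))%R
  (isMeasurableFun.Build _ _ _ _ _ mW).
have := @chernoff _ _ _ P W t (t * v) t0.
rewrite /mmt_gen_fun unlock.
have -> : \int[P]_w ((expR \o t \o* W)%R w)%:E = (expR (t ^+ 2 * v / 2))%:E.
  rewrite -sumv mulr_sumr mulr_suml expR_sum.
  rewrite -(@integral_prod_independent R d T P n X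
    (fun i x => expR (t * a i * (x - mu i ord0)))%R)//.
  - apply: eq_integral => w _; congr (_%:E) => /=.
    rewrite mulr_suml expR_sum; apply: eq_bigr => i _.
    by congr expR; rewrite [LHS]mulrC mulrA.
  - move=> i; apply: measurableT_comp => //; apply: measurable_funM => //.
    exact: measurable_funB.
  - by move=> i; rewrite normal_mgf ?exprMn//; exact: law.
move=> /le_trans; apply; rewrite -EFinM -expRD lee_fin ler_expR.
by lra.
Qed.

(** Two-sided form, normalised by the variance so that it also holds for the
    zero linear form. *)
Lemma gaussian_sq_tail (n : nat) (X : 'I_n -> {RV P >-> R}) (mu : 'cV[R]_n)
    (a : 'I_n -> R) (c : R) :
  std_gaussian_vector X mu -> (0 < c)%R ->
  P [set w | (c * (\sum_i a i ^+ 2) <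
              (\sum_i a i * (X i w - mu i ord0)) ^+ 2)%R] <=
    (2 * expR (- (c / 2)))%:E.
Proof.
move=> gX c0; pose v := (\sum_i a i ^+ 2)%R.
have v0 : (0 <= v)%R by apply: sumr_ge0 => i _; exact: sqr_ge0.
have mX i : measurable_fun setT (X i) by exact: measurable_funP.
have mW (b : 'I_n -> R) :
    measurable_fun setT (fun w => \sum_i b i * (X i w - mu i ord0))%R.
  by apply: measurable_sum => i; apply: measurable_funM => //; apply: measurable_funB.
move: v0; rewrite le_eqVlt => /predU1P[v0|v0].
  rewrite (_ : [set w | _] = set0) ?measure0 ?lee_fin ?mulr_ge0 ?expR_ge0//.
  apply/seteqP; split => // w /=; rewrite -/v -v0 mulr0 big1 ?expr0n ?ltxx//.
  move=> i _; have /eqP := esym v0.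
  rewrite psumr_eq0; last by move=> j _; exact: sqr_ge0.
  by move=> /allP /(_ i); rewrite mem_index_enum sqrf_eq0 => /(_ isT)/eqP->; rewrite mul0r.
pose t : R := Num.sqrt (c / v).
have t0 : (0 < t)%R by rewrite sqrtr_gt0 divr_gt0.
have tv : (t ^+ 2 * v = c)%R.
  by rewrite sqr_sqrtr ?divfK ?gt_eqF// divr_ge0 ?ltW.
pose A (b : 'I_n -> R) := [set w | (t * v <= \sum_i b i * (X i w - mu i ord0))%R].
have mA b : measurable (A b).
  rewrite -[A b]setTI; rewrite (_ : A b =
    (fun w => \sum_i b i * (X i w - mu i ord0))%R @^-1` `[(t * v)%R, +oo[%classic).
    exact: mW.
  by apply/seteqP; split => w /=; rewrite in_itv/= andbT.
apply: (@le_trans _ _ (P (A a `|` A (fun i => - a i)%R))).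
  apply: le_measure; rewrite ?inE.
  - rewrite -[X in measurable X]setTI; rewrite (_ : [set w | _] =
      (fun w => (\sum_i a i * (X i w - mu i ord0)) ^+ 2)%R @^-1` `](c * v)%R, +oo[%classic).
      by apply: measurable_funX.
    by apply/seteqP; split => w /=; rewrite in_itv/= andbT.
  - exact: measurableU.
  move=> w /=; rewrite -/v; set x := (\sum_i a i * _)%R => cx.
  have Ex : (\sum_i (- a i) * (X i w - mu i ord0) = - x)%R.
    by rewrite -sumrN; apply: eq_bigr => i _; rewrite mulNr.
  rewrite /A /= Ex -/x.
  have : (t * v <= `|x|)%R.
    rewrite -ler_sqr ?nnegrE ?mulr_ge0 ?(ltW t0) ?(ltW v0)//.
    rewrite real_normK ?num_real// exprMn [(v ^+ 2)%R]expr2 mulrA tv.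
    exact: ltW.
  by rewrite ler_normr => /orP[]; [left|right].
apply: (le_trans (measureU2 _ _ _)) => //.
have E : (t ^+ 2 * v / 2 = c / 2)%R by rewrite tv.
rewrite mulr2n mulrDl mul1r EFinD -E.
apply: leeD; first exact: (gaussian_tail gX).
apply: (gaussian_tail gX) => //.
by apply: eq_bigr => i _; rewrite sqrrN.
Qed.

Lemma gaussian_sq_union_bound (n N : nat) (X : 'I_n -> {RV P >-> R}) (mu : 'cV[R]_n)
    (a : 'I_N -> 'I_n -> R) (c : R) :
  std_gaussian_vector X mu -> (0 < c)%R ->
  let bad j := [set w | (c * (\sum_i a j i ^+ 2) <
              (\sum_i a j i * (X i w - mu i ord0)) ^+ 2)%R] in
  measurable (\big[setU/set0]_(j < N) bad j) /\
  P (\big[setU/set0]_(j < N) bad j) <= (N%:R * (2 * expR (- (c / 2))))%:E.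
Proof.
move=> gX c0 bad.
have mX i : measurable_fun setT (X i) by exact: measurable_funP.
have mbad j : measurable (bad j).
  rewrite -[bad j]setTI; rewrite (_ : bad j =
    (fun w => (\sum_i a j i * (X i w - mu i ord0)) ^+ 2)%R @^-1`
      `](c * (\sum_i a j i ^+ 2))%R, +oo[%classic).
    apply: measurable_funX => //; apply: measurable_sum => i.
    by apply: measurable_funM => //; apply: measurable_funB.
  by apply/seteqP; split => w /=; rewrite in_itv/= andbT.
split; first exact: bigsetU_measurable.
apply: (@le_trans _ _ (\sum_(j < N) P (bad j))).
  apply: (proj2 (_ : measurable (\big[setU/set0]_(j < N) bad j) /\ _)).
  elim/big_ind2 : _ => [|A s B r [mA As] [mB Br]|j _]; last by split.
    by split => //; rewrite measure0.
  split; first exact: measurableU.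
  by apply: (le_trans (measureU2 _ _ _)) => //; exact: leeD.
apply: (@le_trans _ _ (\sum_(j < N) (2 * expR (- (c / 2)))%:E)).
  by apply: lee_sum => j _; exact: gaussian_sq_tail.
by rewrite sumEFin sumr_const card_ord (mulr_natl _ N).
Qed.

End gaussian.

(** * The estimator and its oracle inequality *)

Section oracle.
Context {R : realType}.
Implicit Types (n k m : nat).

Lemma sqnorm_n_ge0 n (v : 'cV[R]_n) : 0 <= sqnorm_n v.
Proof. by rewrite mulr_ge0 ?invr_ge0// sumr_ge0// => i _; exact: sqr_ge0. Qed.

Lemma norm1_ge0 n (v : 'cV[R]_n) : 0 <= norm1 v.
Proof. by apply: sumr_ge0. Qed.

Lemma coord_sq_le_sqnorm_n n (v : 'cV[R]_n) i : v i 0 ^+ 2 <= n%:R * sqnorm_n v.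
Proof.
case: n v i => [|n] v i; first by case: i.
rewrite /sqnorm_n mulVKf ?pnatr_eq0// (bigD1 i)//= lerDl sumr_ge0// => j _.
exact: sqr_ge0.
Qed.

Lemma continuous_objective_row k n lambda (y : 'cV[R]_n) :
  continuous (fun v : 'rV[R]_n => objective k lambda y v^T).
Proof.
have cM (T : topologicalType) (f g : T -> R) : continuous f -> continuous g ->
    continuous (fun x => f x * g x).
  by move=> cf cg x; apply: cvgM; [exact: cf|exact: cg].
have cD (T : topologicalType) (f g : T -> R) : continuous f -> continuous g ->
    continuous (fun x => f x + g x).
  by move=> cf cg x; apply: cvgD; [exact: cf|exact: cg].
have cabs (T : topologicalType) (f : T -> R) : continuous f ->
    continuous (fun x => `|f x|).
  by move=> cf x; apply: cvg_norm; exact: cf.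
have csum (T : topologicalType) (I : finType) (F : I -> T -> R) :
    (forall i, continuous (F i)) -> continuous (fun v => \sum_i F i v).
  move=> cF; elim: (index_enum I) => [|i r IH].
    by under eq_fun do rewrite big_nil; exact: cst_continuous.
  by under eq_fun do rewrite big_cons; exact: cD.
have ccoord i : continuous (fun v : 'rV[R]_n => v^T i 0 : R).
  by under eq_fun do rewrite mxE; exact: coord_continuous.
rewrite (_ : (fun v => _) = (fun v : 'rV[R]_n =>
    n%:R^-1 * (\sum_i (y i 0 + - 1 * v^T i 0) * (y i 0 + - 1 * v^T i 0)) +
    2 * lambda * \sum_j `|\sum_c Delta R k n j c * v^T c 0|)); last first.
  apply/funext => v; rewrite /objective /sqnorm_n /norm1.
  by congr (_ * _ + _ * _); apply: eq_bigr => i _; rewrite ?expr2 !mxE ?mulN1r.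
have c0 (c : R) : continuous (fun _ : 'rV[R]_n => c) by exact: cst_continuous.
apply: (@cD); apply: (@cM) => //; apply: (@csum) => i.
  by apply: (@cM); apply: (@cD) => //; exact: (@cM).
by apply: cabs; apply: (@csum) => j; exact: (@cM).
Qed.

(** Existence of a minimiser: outside a large cube the residual alone exceeds
    the value of the objective at 0, and the cube is compact. *)
Lemma estimatorP k n lambda (y : 'cV[R]_n) : 0 <= lambda ->
  forall h, objective k lambda y (estimator k lambda y) <= objective k lambda y h.
Proof.
move=> l0.
suff [g gP] : exists g, forall h, objective k lambda y g <= objective k lambda y h.
  by rewrite /estimator; case: xgetP => [g' _ //|/(_ g)].
pose c := n%:R * objective k lambda y 0.
(* |y_i - h_i| <= (y_i - h_i)^2 + 1 <= c + 1 when h does as well as 0 *)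
pose M := (\sum_i `|y i 0|) + (c + 1).
have sum0 : 0 <= \sum_i `|y i 0| by apply: sumr_ge0.
have obj_ge h : sqnorm_n (y - h) <= objective k lambda y h.
  by rewrite lerDl mulr_ge0 ?norm1_ge0// mulr_ge0.
have c0 : 0 <= c.
  by rewrite mulr_ge0// (le_trans _ (obj_ge 0))// sqnorm_n_ge0.
have M0 : 0 <= M by rewrite !addr_ge0.
pose A := [set v : 'rV[R]_n | forall i, v ord0 i \in `[(- M), M]].
have cA : compact A.
  apply: (@rV_compact _  _ (fun=> `[(- M), M]%classic)).
  by move=> _; apply: segment_compact.
have A0 : A 0 by move=> i; rewrite mxE in_itv/= oppr_le0 M0.
have [v Av vmin] := EVT_min_rV (ex_intro _ 0 A0) cA
  (continuous_subspaceT (@continuous_objective_row k n lambda y)).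
exists v^T => h; have [hc|] := leP (objective k lambda y h) (objective k lambda y 0).
  rewrite -[h in leRHS]trmxK; apply: vmin; rewrite inE => i; rewrite in_itv/= -ler_norml mxE.
  have : (y i 0 - h i 0) ^+ 2 <= c.
    have := coord_sq_le_sqnorm_n (y - h) i; rewrite !mxE => /le_trans; apply.
    by rewrite ler_wpM2l// (le_trans (obj_ge h)).
  have : `|y i 0| <= \sum_i `|y i 0| by rewrite (bigD1 i)//= lerDl sumr_ge0.
  rewrite /M; set s := \sum_i _; set a := y i 0; set b := h i 0 => as_ abc.
  have := ler_normB a (a - b); rewrite opprB addrC subrK => /le_trans; apply.
  rewrite lerD// (le_trans _ (_ : (a - b) ^+ 2 + 1 <= _)) ?lerD//.
  by rewrite -real_normK ?num_real//; set z := `|_|; have := sqr_ge0 (z - 2^-1); nra.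
move=> /ltW; apply: le_trans; have := vmin 0; rewrite trmx0; apply.
by rewrite inE.
Qed.

Definition dot n (u v : 'cV[R]_n) : R := \sum_i u i 0 * v i 0.

Lemma dot_mulmx m n (A : 'M[R]_(m, n)) (u : 'cV_m) (v : 'cV_n) :
  dot u (A *m v) = dot (A^T *m u) v.
Proof.
rewrite /dot; under eq_bigr do rewrite mxE mulr_sumr.
rewrite exchange_big/=; apply: eq_bigr => j _; rewrite mxE mulr_suml.
by apply: eq_bigr => i _; rewrite mxE mulrCA mulrA.
Qed.

Lemma norm1_midpoint m (u v : 'cV[R]_m) :
  norm1 (2^-1 *: (u + v)) <= 2^-1 * (norm1 u + norm1 v).
Proof.
rewrite /norm1 -big_split /= mulr_sumr; apply: ler_sum => i _; rewrite !mxE normrM.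
by rewrite ger0_norm ?invr_ge0// ler_wpM2l ?invr_ge0// ler_normD.
Qed.

(** Compare the minimiser with the midpoint of itself and f: the residual is
    quadratic and the penalty is convex, which leaves the gain
    |fh - f|^2 / 2. *)
Lemma basic_inequality k n (lambda : R) (y f0 f : 'cV[R]_n) : 0 <= lambda ->
  let fh := estimator k lambda y in
  sqnorm_n (fh - f0) + 2^-1 * sqnorm_n (fh - f) <=
    sqnorm_n (f - f0) + 2 * n%:R^-1 * dot (y - f0) (fh - f)
    + 2 * lambda * (norm1 (Delta R k n *m f) - norm1 (Delta R k n *m fh)).
Proof.
move=> l0 /=; set fh := estimator _ _ _.
have := estimatorP k y l0 (2^-1 *: (f + fh)); rewrite -/fh /objective.
have := norm1_midpoint (Delta R k n *m f) (Delta R k n *m fh).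
rewrite -mulmxDr scalemxAr.
set Ng := norm1 (_ *m (_ *: _)); set Nf := norm1 _; set Nh := norm1 _.
have E1 : sqnorm_n (y - 2^-1 *: (f + fh)) = 2^-1 * sqnorm_n (y - f) +
    2^-1 * sqnorm_n (y - fh) - 4^-1 * sqnorm_n (fh - f).
  rewrite /sqnorm_n ![_ * (n%:R^-1 * _)]mulrCA -mulrDr -mulrBr; congr (_ * _).
  rewrite !mulr_sumr -big_split -sumrB /=; apply: eq_bigr => i _.
  by rewrite !mxE; field.
have E2 : sqnorm_n (y - fh) - sqnorm_n (y - f) = sqnorm_n (fh - f0)
    - sqnorm_n (f - f0) - 2 * n%:R^-1 * dot (y - f0) (fh - f).
  rewrite /sqnorm_n -mulrA [_ * (n%:R^-1 * _)]mulrCA -!mulrBr; congr (_ * _).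
  rewrite !mulr_sumr -!sumrB; apply: eq_bigr => i _.
  by rewrite !mxE; ring.
rewrite E1 => hN hobj.
have := ler_wpM2l l0 hN; lra.
Qed.

Lemma norm1_split m (S : {set 'I_m}) (u v : 'cV[R]_m) :
  norm1 u - norm1 v <= 2 * (\sum_(r | r \notin S) `|u r 0|) +
    (\sum_(r in S) `|(v - u) r 0| - \sum_(r | r \notin S) `|(v - u) r 0|).
Proof.
rewrite /norm1 (bigID (mem S) predT)/= [X in _ - X](bigID (mem S) predT)/=.
rewrite opprD addrACA addrC -sumrB -sumrB mulr_sumr addrCA -sumrB addrC.
apply: lerD; apply: ler_sum => i _; rewrite !mxE.
  by have := ler_normB (v i 0) (v i 0 - u i 0); rewrite subKr; lra.
have := ler_normB (v i 0) (u i 0); lra.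
Qed.

(** Here s plays the role of the signs of D h on S and q of their
    interpolation.  Row by row, |x| (on S), resp. -|x| (off S), plus
    w x / (n lambda) is at most q x, where x is the entry of D h.  Summing gives
    <q, D h> = <D^T q, h>, and what remains is a quadratic in h. *)
Lemma noise_penalty_bound k n (lambda E : R) (S : {set 'I_(n - k)})
    (e p : 'cV[R]_n) (w : 'cV[R]_(n - k)) (h : 'cV[R]_n) :
  (0 < n)%N -> 0 < lambda ->
  (forall h, dot e h = dot p h + dot w (Delta R k n *m h)) ->
  (forall r, r \in S -> w r 0 = 0) ->
  (forall s : 'I_(n - k) -> R, (forall r, `|s r| <= 1) ->
    exists q : 'cV[R]_(n - k), [/\ forall r, r \in S -> q r 0 = s r,
      forall r, r \notin S -> `|w r 0| <= n%:R * lambda * (1 - `|q r 0|) &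
      \sum_i ((Delta R k n)^T *m q) i 0 ^+ 2 <= E]) ->
  2 * n%:R^-1 * dot e h + 2 * lambda *
   (\sum_(r in S) `|(Delta R k n *m h) r 0|
    - \sum_(r | r \notin S) `|(Delta R k n *m h) r 0|) - 2^-1 * sqnorm_n h <=
  4 * n%:R^-1 * (\sum_i p i 0 ^+ 2) + 4 * n%:R * lambda ^+ 2 * E.
Proof.
move=> n0 l0 dec wS interp.
have nR0 : 0 < n%:R :> R by rewrite ltr0n.
set x := Delta R k n *m h.
have [q [qS qN qE]] : exists q : 'cV[R]_(n - k),
    [/\ forall r, r \in S -> q r 0 = Num.sg (x r 0),
      forall r, r \notin S -> `|w r 0| <= n%:R * lambda * (1 - `|q r 0|) &
      \sum_i ((Delta R k n)^T *m q) i 0 ^+ 2 <= E].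
  apply: interp => r; rewrite normr_sg; case: eqP => //.
have pt : n%:R * lambda * (\sum_(r in S) `|x r 0| - \sum_(r | r \notin S) `|x r 0|)
    + dot w x <= n%:R * lambda * dot q x.
  rewrite /dot [X in _ + X](bigID (mem S) predT)/=.
  rewrite [X in _ <= _ * X](bigID (mem S) predT)/= mulrBr mulrDr addrACA.
  rewrite !mulr_sumr -sumrN -!big_split/=.
  apply: lerD; apply: ler_sum => r rS.
    by rewrite wS// mul0r addr0 qS// -normrEsg.
  have := qN r rS; set c := n%:R * lambda; set a := x r 0; set b := q r 0.
  set v := w r 0 => vb.
  have c0 : 0 <= c by rewrite mulr_ge0// ltW.
  have h1 : v * a <= `|v| * `|a| by rewrite -normrM ler_norm.
  have h2 : - (`|b| * `|a|) <= b * a by rewrite -normrM lerNnormlW.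
  have := ler_wpM2r (normr_ge0 a) vb.
  have := ler_wpM2l c0 h2; nra.
rewrite dec -/x; move: pt; rewrite [dot q x]dot_mulmx.
set d := _^T *m q in qE *; set AA := _ - _; set W := dot w x => pt.
have {}pt : 2 * n%:R^-1 * W + 2 * lambda * AA <= 2 * lambda * dot d h.
  have : 2 * n%:R^-1 * (n%:R * lambda * AA + W) <= 2 * n%:R^-1 * (n%:R * lambda * dot d h).
    by apply: ler_wpM2l pt; rewrite mulr_ge0// invr_ge0.
  have -> : 2 * n%:R^-1 * (n%:R * lambda * AA + W) = 2 * n%:R^-1 * W + 2 * lambda * AA :> R.
    by field; rewrite gt_eqF.
  by have -> : 2 * n%:R^-1 * (n%:R * lambda * dot d h) = 2 * lambda * dot d h :> R
    by field; rewrite gt_eqF.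
have : 4 * n%:R * lambda ^+ 2 * \sum_i d i 0 ^+ 2 <= 4 * n%:R * lambda ^+ 2 * E.
  by apply: ler_wpM2l qE; rewrite mulr_ge0 ?sqr_ge0// mulr_ge0.
suff : 2 * n%:R^-1 * dot p h + 2 * lambda * dot d h - 2^-1 * sqnorm_n h <=
    4 * n%:R^-1 * (\sum_i p i 0 ^+ 2) + 4 * n%:R * lambda ^+ 2 * \sum_i d i 0 ^+ 2.
  rewrite mulrDr; move: pt; move: (2 * lambda * dot d h) (2 * lambda * AA).
  move: (2 / n%:R * W) (2 / n%:R * dot p h) (2^-1 * sqnorm_n h).
  move: (_ * _ * E) (_ * \sum_i d i 0 ^+ 2) (_ * \sum_i p i 0 ^+ 2).
  by move=> x1 x2 x3 x4 x5 x6 x7 x8 h1 h2 h3; lra.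
rewrite /sqnorm_n /dot mulrA !mulr_sumr -big_split -sumrB -big_split/=.
apply: ler_sum => i _.
set a := p i 0; set b := d i 0; set z := h i 0.
rewrite -subr_ge0.
have -> : 4 * n%:R^-1 * a ^+ 2 + 4 * n%:R * lambda ^+ 2 * b ^+ 2 -
   (2 * n%:R^-1 * (a * z) + 2 * lambda * (b * z) - 2^-1 / n%:R * z ^+ 2) =
   n%:R^-1 * (2^-1 * (z - 2 * (a + n%:R * lambda * b)) ^+ 2 +
              2 * (a - n%:R * lambda * b) ^+ 2) :> R.
  by field; rewrite gt_eqF.
by rewrite mulr_ge0 ?invr_ge0// addr_ge0// mulr_ge0// ?invr_ge0// sqr_ge0.
Qed.

Lemma oracle_inequality k n (lambda E : R) (S : {set 'I_(n - k)})
    (y f0 f p : 'cV[R]_n) (w : 'cV[R]_(n - k)) :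
  (0 < n)%N -> 0 < lambda ->
  (forall h, dot (y - f0) h = dot p h + dot w (Delta R k n *m h)) ->
  (forall r, r \in S -> w r 0 = 0) ->
  (forall s : 'I_(n - k) -> R, (forall r, `|s r| <= 1) ->
    exists q : 'cV[R]_(n - k), [/\ forall r, r \in S -> q r 0 = s r,
      forall r, r \notin S -> `|w r 0| <= n%:R * lambda * (1 - `|q r 0|) &
      \sum_i ((Delta R k n)^T *m q) i 0 ^+ 2 <= E]) ->
  sqnorm_n (estimator k lambda y - f0) <=
    sqnorm_n (f - f0) + 4 * lambda * norm1_off S f +
    (4 * n%:R^-1 * (\sum_i p i 0 ^+ 2) + 4 * n%:R * lambda ^+ 2 * E).
Proof.
move=> n0 l0 dec wS interp.
have := noise_penalty_bound (estimator k lambda y - f) n0 l0 dec wS interp.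
have := basic_inequality k y f0 f (ltW l0).
have := norm1_split S (Delta R k n *m f) (Delta R k n *m estimator k lambda y).
rewrite -mulmxBr -/(norm1_off S f) /=.
set a := \sum_(r in S) _; set b := \sum_(r | _) _.
set D := norm1 _ - _ => /(ler_wpM2l (ltW l0)); lra.
Qed.

(** Comparison with f0 in the definition of the estimator; used on the event
    where the noise is too large. *)
Lemma crude_bound k n (lambda : R) (y f0 : 'cV[R]_n) : 0 <= lambda ->
  sqnorm_n (estimator k lambda y - f0) <=
    4 * sqnorm_n (y - f0) + 4 * lambda * norm1 (Delta R k n *m f0).
Proof.
move=> l0; have := estimatorP k y l0 f0; rewrite /objective.
set fh := estimator _ _ _.
have := mulr_ge0 l0 (norm1_ge0 (Delta R k n *m fh)).
have : sqnorm_n (fh - f0) <= 2 * sqnorm_n (y - fh) + 2 * sqnorm_n (y - f0).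
  rewrite /sqnorm_n ![2 * (_ * _)]mulrCA -mulrDr ler_wpM2l ?invr_ge0// !mulr_sumr -big_split/=.
  apply: ler_sum => i _; rewrite !mxE.
  by set a := fh i 0; set b := y i 0; set c := f0 i 0; have := sqr_ge0 (b - a + (b - c)); nra.
lra.
Qed.

End oracle.

(** * Splitting the noise along the rows of a surjective matrix *)

Section pseudo_inverse.
Context {R : realType}.

Lemma dotE n (u v : 'cV[R]_n) : dot u v = (u^T *m v) 0 0.
Proof. by rewrite mxE; apply: eq_bigr => i _; rewrite mxE. Qed.

Lemma gram_unitmx p n (M : 'M[R]_(p, n)) (B : 'M[R]_(n, p)) :
  M *m B = 1%:M -> M *m M^T \in unitmx.
Proof.
move=> MB; rewrite -row_free_unit -kermx_eq0; set K := kermx _.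
have KG : K *m (M *m M^T) = 0 by rewrite mulmx_ker.
suff KM : K *m M = 0 by rewrite -[K]mulmx1 -MB mulmxA KM mul0mx.
have : (K *m M) *m (K *m M)^T = 0.
  by rewrite trmx_mul mulmxA -[_ *m M *m _]mulmxA KG mul0mx.
move=> /matrixP N0; apply/matrixP => i j; have := N0 i i.
rewrite mxE [RHS]mxE => /eqP.
rewrite psumr_eq0; last by move=> l _; rewrite [_^T _ _]mxE -expr2 sqr_ge0.
move=> /allP /(_ j); rewrite mem_index_enum [_^T _ _]mxE mulf_eq0 orbb.
by move=> /(_ isT)/eqP ->; rewrite mxE.
Qed.

(** A = M^T (M M^T)^-1 is the pseudo-inverse of M and A M the orthogonal
    projection onto the row space of M.  The j-th column of A is the projection
    of any solution c of M c = delta_j, hence the shortest one.  For the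
    projection Q = 1 - A M, the sum of the squared entries is the trace. *)
Lemma orthogonal_splitting p n (M : 'M[R]_(p, n)) (B : 'M[R]_(n, p)) :
  M *m B = 1%:M ->
  exists (A : 'M[R]_(n, p)) (Q : 'M[R]_n),
  [/\ forall e h : 'cV[R]_n, dot e h = dot (Q *m e) h + dot (A^T *m e) (M *m h),
      forall (j : 'I_p) (c : 'cV[R]_n), M *m c = delta_mx j 0 ->
        \sum_i A i j ^+ 2 <= \sum_i c i 0 ^+ 2 &
      \sum_i \sum_l Q i l ^+ 2 = n%:R - p%:R].
Proof.
move=> MB; have GU := gram_unitmx MB; set G := M *m M^T in GU.
pose A := M^T *m invmx G; pose Z := A *m M.
have MA : M *m A = 1%:M by rewrite mulmxA mulmxV.
have GT : G^T = G by rewrite trmx_mul trmxK.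
have ZT : Z^T = Z by rewrite /Z /A !trmx_mul trmxK trmx_inv GT mulmxA.
have ZZ : Z *m Z = Z by rewrite /Z -mulmxA [M *m _]mulmxA MA mul1mx.
pose Q := 1%:M - Z.
have QT : Q^T = Q by rewrite /Q linearB/= ZT trmx1.
have QQ : Q *m Q = Q.
  by rewrite {1}/Q mulmxBl mul1mx /Q mulmxBr ZZ mulmx1 subrr subr0.
exists A, Q; split.
- move=> e h; rewrite !dotE.
  suff -> : e^T *m h = (Q *m e)^T *m h + (A^T *m e)^T *m (M *m h) by rewrite mxE.
  rewrite [(Q *m e)^T]trmx_mul QT [(A^T *m e)^T]trmx_mul trmxK.
  rewrite [in X in _ + X]mulmxA -[e^T *m A *m M]mulmxA -/Z -mulmxDl -mulmxDr.
  by rewrite /Q subrK mulmx1.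
- move=> j c Mc.
  have Zc i : (Z *m c) i 0 = A i j.
    by rewrite /Z -mulmxA Mc -colE mxE.
  have E (u : 'cV[R]_n) : \sum_i u i 0 ^+ 2 = (u^T *m u) 0 0.
    by rewrite mxE; apply: eq_bigr => i _; rewrite mxE.
  have -> : \sum_i A i j ^+ 2 = \sum_i (Z *m c) i 0 ^+ 2.
    by apply: eq_bigr => i _; rewrite Zc.
  rewrite !E trmx_mul ZT -mulmxA [Z *m (_ *m _)]mulmxA ZZ -subr_ge0.
  have -> : (c^T *m c) 0 0 - (c^T *m (Z *m c)) 0 0 = ((Q *m c)^T *m (Q *m c)) 0 0.
    have -> : (Q *m c)^T *m (Q *m c) = c^T *m (Q *m c).
      by rewrite trmx_mul QT -{3}QQ -!mulmxA.
    rewrite /Q mulmxBl mul1mx mulmxBr.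
    by rewrite [in RHS]mxE; congr (_ + _); rewrite [RHS]mxE.
  by rewrite -E sumr_ge0// => i _; exact: sqr_ge0.
- transitivity (\tr (Q *m Q^T)).
    apply: eq_bigr => i _; rewrite [RHS]mxE; apply: eq_bigr => l _.
    by rewrite [_^T _ _]mxE expr2.
  by rewrite QT QQ /Q linearB/= mxtrace1 /Z mxtrace_mulC MA mxtrace1.
Qed.

End pseudo_inverse.

(** * Iterated differences and truncated powers *)

Section differences.
Context {R : realType}.
Implicit Types (F G : int -> R) (x y : int).

(** Backward difference of order k on two-sided sequences, so that boundary
    effects of the matrix [Delta] only appear in [Delta_mulmx] and
    [Delta_trmx_mulmx]. *)
Fixpoint bdiff k G x : R :=
  if k is k'.+1 then bdiff k' G x - bdiff k' G (x - 1) else G x.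

Lemma bdiffSr k G x : bdiff k.+1 G x = bdiff k (fun y => G y - G (y - 1)) x.
Proof. by elim: k x => [|k IH] x //=; rewrite -!IH. Qed.

Lemma eq_bdiff k F G x :
  (forall y, x - k%:Z <= y <= x -> F y = G y) -> bdiff k F x = bdiff k G x.
Proof.
elim: k x => [|k IH] x FG /=; first by apply: FG; lia.
by congr (_ - _); apply: IH => y hy; apply: FG; lia.
Qed.

Lemma bdiff0 k F x :
  (forall y, x - k%:Z <= y <= x -> F y = 0) -> bdiff k F x = 0.
Proof.
move=> F0; rewrite (@eq_bdiff _ _ (fun=> 0))//.
by elim: k x {F0} => [|k IH] x //=; rewrite !IH subrr.
Qed.

Lemma bdiffZ k (c : R) F x : bdiff k (fun y => c * F y) x = c * bdiff k F x.
Proof. by elim: k x => [|k IH] x //=; rewrite !IH mulrBr. Qed.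

Lemma bdiff_sum k (I : finType) (P : pred I) (F : I -> int -> R) x :
  bdiff k (fun y => \sum_(i | P i) F i y) x = \sum_(i | P i) bdiff k (F i) x.
Proof. by elim: k x => [|k IH] x //=; rewrite !IH sumrB. Qed.

Lemma bdiffD k F G x :
  bdiff k (fun y => F y + G y) x = bdiff k F x + bdiff k G x.
Proof. by elim: k x => [|k IH] x //=; rewrite !IH opprD addrACA. Qed.

Lemma bdiff_shift k F t x : bdiff k (fun y => F (y - t)) x = bdiff k F (x - t).
Proof. by elim: k x => [|k IH] x //=; rewrite !IH addrAC. Qed.

Lemma bdiff_opp k F x :
  bdiff k (fun y => F (- y)) x = (- 1) ^+ k * bdiff k F (k%:Z - x).
Proof.
elim: k x => [|k IH] x /=; first by rewrite mul1r sub0r.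
have -> : k.+1%:Z - x = k%:Z - (x - 1) by lia.
have -> : k%:Z - (x - 1) - 1 = k%:Z - x by lia.
by rewrite !IH exprS; ring.
Qed.

Lemma bdiffE k G x :
  bdiff k G x = \sum_(l < k.+1) (- 1) ^+ l * 'C(k, l)%:R * G (x - l%:Z).
Proof.
elim: k x => [|k IH] x /=.
  by rewrite big_ord_recl big_ord0 /= bin0 expr0 !mul1r subr0 addr0.
rewrite !IH [RHS]big_ord_recl /= !expr0 mul1r !bin0 subr0 mul1r.
under [X in _ = _ + X]eq_bigr => l _ do
  rewrite /bump /= add1n binS natrD mulrDr mulrDl.
rewrite big_split /= addrA; congr (_ + _).
  rewrite [X in _ = _ + X]big_ord_recr /= bin_small// mulr0 mul0r addr0.
  rewrite big_ord_recl /= !expr0 bin0 subr0 !mul1r; congr (_ + _).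
rewrite -sumrN; apply: eq_bigr => l _.
rewrite exprS mulN1r !mulNr; congr (- (_ * G _)); lia.
Qed.

(** Turns the binomial sum of [bdiffE] into the entries of [Delta]: for given
    indices a and b at most one l contributes. *)
Lemma sum_ord_eqD (V : nmodType) k a b (F : nat -> V) :
  \sum_(l < k.+1 | (a + l == b)%N) F l = if (a <= b <= a + k)%N then F (b - a)%N else 0.
Proof.
case: ifPn => [/andP[ab bk]|nab].
  have lk : (b - a < k.+1)%N by lia.
  by rewrite (big_pred1 (Ordinal lk))// => l; rewrite /= -(inj_eq val_inj) /=; lia.
by rewrite big_pred0// => l; have := ltn_ord l; lia.
Qed.

Lemma Delta_mulmx k n (g : 'cV[R]_n) G (r : 'I_(n - k)) :
  (forall c : 'I_n, G (c : nat)%:Z = g c 0) ->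
  (Delta R k n *m g) r 0 = bdiff k G (k + r)%:Z.
Proof.
move=> Gg; rewrite bdiffE mxE.
transitivity (\sum_(l < k.+1) \sum_(c < n | (c + l == k + r)%N)
    (- 1) ^+ l * 'C(k, l)%:R * g c 0); last first.
  apply: eq_bigr => l _; have lk := ltn_ord l; have rk := ltn_ord r.
  have cn : (k + r - l < n)%N by lia.
  rewrite (big_pred1 (Ordinal cn)) => [|c]; last by rewrite /= -(inj_eq val_inj) /=; lia.
  by rewrite -Gg /=; congr (_ * G _); lia.
rewrite (exchange_big_dep predT)//=; apply: eq_bigr => c _; rewrite mxE.
rewrite -mulr_suml (sum_ord_eqD k c (k + r) (fun l => (- 1) ^+ l * 'C(k, l)%:R)).
by rewrite /= addSn !ltnS subSS.
Qed.

(** The transpose is a forward difference, which is the backward difference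
    read from the other end: C(k, l) = C(k, k - l) accounts for the sign. *)
Lemma Delta_trmx_mulmx k n (q : 'cV[R]_(n - k)) G (c : 'I_n) :
  (forall r : 'I_(n - k), G (r : nat)%:Z = q r 0) ->
  (forall x, ~~ (0 <= x < (n - k)%N%:Z) -> G x = 0) ->
  ((Delta R k n)^T *m q) c 0 = (- 1) ^+ k * bdiff k G (c : nat)%:Z.
Proof.
move=> Gq G0; rewrite bdiffE mxE mulr_sumr.
transitivity (\sum_(l < k.+1) \sum_(r < n - k | (r + l == c)%N)
    (- 1) ^+ (k + l) * 'C(k, l)%:R * q r 0); last first.
  apply: eq_bigr => l _; have lk := ltn_ord l; have cn := ltn_ord c.
  have [lc|lc] := boolP ((l <= c) && (c - l < n - k))%N.
    have /andP[lc1 lc2] := lc.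
    rewrite (big_pred1 (Ordinal lc2)) => [|r]; last by rewrite /= -(inj_eq val_inj) /=; lia.
    by rewrite -Gq /= exprD !mulrA; congr (_ * G _); lia.
  rewrite G0 ?mulr0; last by lia.
  by rewrite big_pred0// => r; have := ltn_ord r; lia.
rewrite (exchange_big_dep predT)//=; apply: eq_bigr => r _; rewrite !mxE.
rewrite -mulr_suml (sum_ord_eqD k r c (fun l => (- 1) ^+ (k + l) * 'C(k, l)%:R)).
congr (_ * _); rewrite /= addSn !ltnS subSS [(c + k)%N]addnC leq_add2l andbC.
rewrite [(k + r)%N]addnC; case: ifP => // /andP[rc ck].
have -> : (r + k - c = k - (c - r))%N by lia.
rewrite bin_sub; last by lia.
congr (_ * _); rewrite -signr_odd -[RHS]signr_odd; congr (_ ^+ (nat_of_bool _)); lia.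
Qed.

(** The coefficients of (1 - z)^-(j+1): the fundamental solution of the
    difference operator of order j + 1, and a polynomial of degree j on the
    nonnegative integers. *)
Definition trunc_pow j x : R := if x is Posz n then 'C(n + j, j)%:R else 0.

Lemma trunc_pow_neg j x : x < 0 -> trunc_pow j x = 0.
Proof. by case: x. Qed.

Lemma bdiff_trunc_pow j x : bdiff j.+1 (trunc_pow j) x = (x == 0)%:R.
Proof.
elim: j => [|j IH].
  case: x => [[|x]|x] //=; rewrite ?subr0 ?bin0 ?subrr//.
rewrite bdiffSr -IH; apply: eq_bdiff => y _.
case: y => [[|y]|y]; rewrite ?subr0 //=.
- by rewrite !add0n !binn.
- rewrite subn1 /=.
  by rewrite addSn binS natrD addrAC subrr add0r addSnnS.
Qed.

Lemma binDl_le_exp a j : ('C(a + j, j) <= a.+1 ^ j)%N.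
Proof.
elim: j => [|j IH]; first by rewrite bin0.
rewrite -(leq_pmul2l (ltn0Sn j)) addnS -mul_bin_diag expnS mulnCA.
apply: (@leq_trans ((a + j).+1 * a.+1 ^ j)%N); first by rewrite leq_mul2l IH orbT.
rewrite mulnA leq_mul2r; apply/orP; right; nia.
Qed.

Lemma trunc_pow_sq_le j x (d : nat) : x < d%:Z ->
  trunc_pow j x ^+ 2 <= d%:R ^+ (2 * j).
Proof.
case: x => [a|a] ad /=; last by rewrite expr0n exprn_ge0.
rewrite mulnC exprM ler_sqr ?nnegrE ?exprn_ge0// -natrX ler_nat.
apply: (leq_trans (binDl_le_exp _ _)).
by case: j => // j; rewrite leq_exp2r//; lia.
Qed.

End differences.

(** * Splitting the noise along the penalised differences *)

Section atoms.
Context {R : realType}.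

Lemma card_ord_itv n a b : (\sum_(c < n | a <= c < b) 1 <= b - a)%N.
Proof.
suff : (\sum_(c < n | a <= c < b) 1 <= minn n b - a)%N by move=> /leq_trans; apply; lia.
elim: n => [|n IH]; first by rewrite big_ord0.
rewrite big_mkcond big_ord_recr /= -big_mkcond /=; move: IH.
by set s := bigop _ _ _; case: ifP => h IH; lia.
Qed.

Lemma sum_sq_supported n a b d j (g : 'cV[R]_n) : (b - a <= d)%N ->
  (forall c : 'I_n, ~~ (a <= c < b)%N -> g c 0 = 0) ->
  (forall c : 'I_n, (a <= c < b)%N -> g c 0 ^+ 2 <= d%:R ^+ j) ->
  \sum_c g c 0 ^+ 2 <= d%:R ^+ j.+1.
Proof.
move=> abd g0 gd; rewrite (bigID (fun c : 'I_n => a <= c < b)%N)/=.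
rewrite [X in _ + X]big1 ?addr0; last by move=> c /g0 ->; rewrite expr0n.
apply: (le_trans (ler_sum _ gd)).
have -> : \sum_(c < n | (a <= c < b)%N) d%:R ^+ j =
    (\sum_(c < n | (a <= c < b)%N) 1)%N%:R * d%:R ^+ j :> R.
  by rewrite natr_sum mulr_suml; apply: eq_bigr => c _; rewrite mul1r.
by rewrite exprS ler_wpM2r ?exprn_ge0// ler_nat (leq_trans (card_ord_itv n a b)).
Qed.

(** The truncated power with its unit difference at row r, cut off past t: the
    cut creates nonzero differences only at the rows t, ..., t + k - 1.  With
    t = n - k nothing is cut. *)
Lemma atom_before k n r t : (0 < k)%N -> (r < t)%N ->
  exists c : 'cV[R]_n,
    (forall rho : 'I_(n - k), (rho < t)%N || (t + k <= rho)%N ->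
       (Delta R k n *m c) rho 0 = (rho == r :> nat)%:R) /\
    \sum_i c i 0 ^+ 2 <= (t - r)%:R ^+ (2 * k - 1).
Proof.
case: k => // j _ rt.
pose G (x : int) : R :=
  if x < (t + j.+1)%:Z then trunc_pow j (x - (r + j.+1)%:Z) else 0.
exists (\col_c G (c : nat)%:Z); split=> [rho rhoP|].
  rewrite (@Delta_mulmx _ _ _ _ G) => [|c]; last by rewrite mxE.
  have /orP[rhot|trho] := rhoP.
    rewrite (@eq_bdiff _ _ _ (fun x => trunc_pow j (x - (r + j.+1)%:Z))) => [|y hy].
      by rewrite bdiff_shift bdiff_trunc_pow; congr (_%:R); lia.
    by rewrite /G ifT//; lia.
  rewrite bdiff0 => [|y hy]; last by rewrite /G ifF//; lia.
  by have -> : (rho == r :> nat) = false by lia.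
have -> : (2 * j.+1 - 1 = (2 * j).+1)%N by lia.
apply: (@sum_sq_supported _ (r + j.+1) (t + j.+1)); first by lia.
- move=> c hc; rewrite mxE /G; case: ifP => // ct.
  by rewrite trunc_pow_neg//; lia.
- move=> c hc; rewrite mxE /G ifT; last by lia.
  by apply: trunc_pow_sq_le; lia.
Qed.

(** The mirror image of [atom_before], for a knot t on the other side of r. *)
Lemma atom_after k n r t : (0 < k)%N -> (t + k <= r)%N ->
  exists c : 'cV[R]_n,
    (forall rho : 'I_(n - k), (rho < t)%N || (t + k <= rho)%N ->
       (Delta R k n *m c) rho 0 = (rho == r :> nat)%:R) /\
    \sum_i c i 0 ^+ 2 <= (r - t)%:R ^+ (2 * k - 1).
Proof.
case: k => // j _ tr.
pose H (x : int) : R := (- 1) ^+ j.+1 * trunc_pow j (- (x - r%:Z)).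
pose G (x : int) : R := if (t + j.+1)%:Z <= x then H x else 0.
exists (\col_c G (c : nat)%:Z); split=> [rho rhoP|].
  rewrite (@Delta_mulmx _ _ _ _ G) => [|c]; last by rewrite mxE.
  have /orP[rhot|trho] := rhoP.
    rewrite bdiff0 => [|y hy]; last by rewrite /G ifF//; lia.
    by have -> : (rho == r :> nat) = false by lia.
  rewrite (@eq_bdiff _ _ _ H) => [|y hy]; last by rewrite /G ifT//; lia.
  rewrite bdiffZ (bdiff_shift _ (fun y => trunc_pow j (- y))) bdiff_opp.
  rewrite bdiff_trunc_pow mulrA -exprD addnn -signr_odd odd_double mul1r.
  by congr (_%:R); lia.
have -> : (2 * j.+1 - 1 = (2 * j).+1)%N by lia.
apply: (@sum_sq_supported _ (t + j.+1) r.+1); first by lia.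
- move=> c hc; rewrite mxE /G; case: ifP => // ct.
  by rewrite /H trunc_pow_neg ?mulr0//; lia.
- move=> c hc; rewrite mxE /G ifT; last by lia.
  rewrite /H exprMn sqrr_sign mul1r; apply: trunc_pow_sq_le; lia.
Qed.

(** Freeing k consecutive rows at each knot decouples the two sides: a
    truncated power can be cut there. *)
Definition thick k n (S : {set 'I_(n - k)}) : {set 'I_(n - k)} :=
  [set r : 'I_(n - k) | [exists t in S, (t <= r < t + k)%N]].

Lemma subset_thick k n (S : {set 'I_(n - k)}) : (0 < k)%N -> S \subset thick S.
Proof.
move=> k0; apply/fintype.subsetP => t tS; rewrite inE; apply/existsP; exists t.
by rewrite tS leqnn -addn1 leq_add2l.
Qed.

Lemma card_thick k n (S : {set 'I_(n - k)}) : (#|thick S| <= k * #|S|)%N.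
Proof.
pose f (p : 'I_k * 'I_(n - k)) : option 'I_(n - k) := insub (p.2 + p.1)%N.
have : ([set Some r | r in thick S] \subset f @: finset.setX [set: 'I_k] S)%SET.
  apply/fintype.subsetP => _ /imsetP[r + ->]; rewrite inE => /existsP[t /andP[tS tr]].
  have lk : (r - t < k)%N by lia.
  apply/imsetP; exists (Ordinal lk, t); first by rewrite !inE.
  by rewrite /f /= subnKC ?valK//; lia.
move=> /subset_leq_card; rewrite card_imset; last by move=> ? ? [].
move=> /leq_trans; apply; apply: (leq_trans (leq_imset_card _ _)).
by rewrite cardsX cardsT card_ord.
Qed.

(** [orthogonal_splitting] for the rows of [Delta] outside [thick S], the
    coordinates being put back at their rows and completed by zeros.  The
    dimension count is n - (n - k - #|thick S|) = k + #|thick S|. *)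
Lemma noise_splitting k n (S : {set 'I_(n - k)}) : (0 < k <= n)%N ->
  exists (a : 'M[R]_(n, n - k)) (Q : 'M[R]_n),
  [/\ forall e h : 'cV[R]_n,
        dot e h = dot (Q *m e) h + dot (a^T *m e) (Delta R k n *m h),
      forall r, r \in S -> forall i, a i r = 0,
      forall r t : 'I_(n - k), t \in S ->
        \sum_i a i r ^+ 2 <= `|r - t|%N%:R ^+ (2 * k - 1),
      forall r, \sum_i a i r ^+ 2 <= (n - k)%:R ^+ (2 * k - 1) &
      \sum_i \sum_l Q i l ^+ 2 <= (k * #|S|.+1)%:R].
Proof.
move=> /andP[k0 kn]; pose C := ~: thick S; pose p := #|C|.
pose ev (j : 'I_p) : 'I_(n - k) := enum_val j.
have ev_inj : injective ev by exact: enum_val_inj.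
have evP j : ev j \in C by exact: enum_valP.
pose sel : 'M[R]_(p, n - k) := \matrix_(j, r) (ev j == r)%:R.
pose M := sel *m Delta R k n.
have selE (u : 'cV[R]_(n - k)) j : (sel *m u) j 0 = u (ev j) 0.
  rewrite mxE (bigD1 (ev j))//= mxE eqxx mul1r big1 ?addr0// => r.
  by rewrite mxE eq_sym => /negbTE ->; rewrite mul0r.
have outC (t r : 'I_(n - k)) : t \in S -> r \in C -> (r < t)%N || (t + k <= r)%N.
  move=> tS; rewrite !inE => /existsPn/(_ t); rewrite tS /=; lia.
have atomM (c : 'cV[R]_n) (t : nat) j :
    (forall r, r \in C -> (r < t)%N || (t + k <= r)%N) ->
    (forall rho : 'I_(n - k), (rho < t)%N || (t + k <= rho)%N ->
       (Delta R k n *m c) rho 0 = (rho == ev j :> nat)%:R) ->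
    M *m c = delta_mx j 0.
  move=> hC hc; apply/matrixP => i x; rewrite ord1 -mulmxA selE hc; last first.
    by apply: hC; exact: evP.
  by rewrite mxE eqxx andbT (inj_eq val_inj) (inj_eq ev_inj).
have far r : r \in C -> (r < n - k)%N || (n - k + k <= r)%N by rewrite ltn_ord.
have [B MB] : exists B : 'M[R]_(n, p), M *m B = 1%:M.
  have /(_ _)/cid-/all_sig[c cP] : forall j : 'I_p, exists c : 'cV[R]_n, M *m c = delta_mx j 0.
    move=> j; have [c [c1 _]] := @atom_before k n (ev j) (n - k) k0 (ltn_ord _).
    by exists c; apply: atomM c1; exact: far.
  exists (\matrix_(i, j) c j i 0); apply/matrixP => i j.
  have /matrixP/(_ i 0) := cP j; rewrite !mxE eqxx andbT => <-.
  by apply: eq_bigr => l _; rewrite [(\matrix_(_, _) _) _ _]mxE.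
have [A [Q [dec minA trQ]]] := orthogonal_splitting MB.
have aE r i : (A *m sel) i r = \sum_j A i j * (ev j == r)%:R.
  by rewrite mxE; apply: eq_bigr => j _; rewrite mxE.
have aj j i : (A *m sel) i (ev j) = A i j.
  rewrite aE (bigD1 j)//= eqxx mulr1 big1 ?addr0// => l lj.
  by rewrite (inj_eq ev_inj) (negbTE lj) mulr0.
have a0 r i : r \in thick S -> (A *m sel) i r = 0.
  move=> rT; rewrite aE big1// => j _; have := evP j; rewrite inE.
  by case: eqP => [->|]; rewrite ?rT ?mulr0.
have abound r b : (forall j, r = ev j -> \sum_i A i j ^+ 2 <= b) -> 0 <= b ->
    \sum_i (A *m sel) i r ^+ 2 <= b.
  move=> hb b0; have [rT|rT] := boolP (r \in thick S).
    by rewrite big1// => i _; rewrite a0// expr0n.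
  have rC : r \in C by rewrite inE.
  pose j : 'I_p := enum_rank_in rC r.
  have Ej : ev j = r by exact: (enum_rankK_in rC rC).
  by have := hb j (esym Ej); under eq_bigr do rewrite -aj Ej.
exists (A *m sel), Q; split.
- by move=> e h; rewrite dec trmx_mul -[in RHS]mulmxA -mulmxA dot_mulmx.
- by move=> r rS i; rewrite a0// (fintype.subsetP (subset_thick S k0)).
- move=> r t tS; apply: abound; last by rewrite exprn_ge0.
  move=> j ->; have := outC t (ev j) tS (evP j).
  move=> /orP[rt|tr].
    have [c [c1 c2]] := @atom_before k n (ev j) t k0 rt.
    apply: (le_trans (minA j c _)); first by apply: atomM c1 => r' /outC; exact.
    by apply: (le_trans c2); have -> : `|ev j - t|%N = (t - ev j)%N by lia.
  have [c [c1 c2]] := @atom_after k n (ev j) t k0 tr.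
  apply: (le_trans (minA j c _)); first by apply: atomM c1 => r' /outC; exact.
  by apply: (le_trans c2); have -> : `|ev j - t|%N = (ev j - t)%N by lia.
- move=> r; apply: abound; last by rewrite exprn_ge0.
  move=> j _; have [c [c1 c2]] := @atom_before k n (ev j) (n - k) k0 (ltn_ord _).
  apply: (le_trans (minA j c _)); first by apply: atomM c1; exact: far.
  by apply: (le_trans c2); rewrite lerXn2r ?nnegrE// ler_nat leq_subr.
- rewrite trQ lerBlDr -natrD ler_nat.
  have := card_thick S; have := cardsC (thick S); rewrite card_ord -/C -/p; lia.
Qed.

End atoms.

(** * A hat function with small differences *)

Section smoothing.
Context {R : realType}.
Implicit Types (F G : int -> R) (x y : int) (h k j l L : nat).

Definition avg h F x : R := h%:R^-1 * \sum_(j < h) F (x - j%:Z).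

Definition sdiff h F x : R := h%:R^-1 * (F x - F (x - h%:Z)).

Definition step x : R := (0 < x)%R%:R.

Lemma avg_diff h F x : avg h F x - avg h F (x - 1) = sdiff h F x.
Proof.
rewrite /avg /sdiff -mulrBr; congr (_ * _).
elim: h => [|h IH]; first by rewrite !big_ord0 !subr0 subrr.
rewrite !big_ord_recr /= opprD addrACA IH.
have -> : x - 1 - h%:Z = x - h.+1%:Z by lia.
by rewrite addrA subrK.
Qed.

(** Each average absorbs one difference: the difference of an average over h
    points is 1/h times the difference at distance h. *)
Lemma bdiff_iter_avg k h F x :
  bdiff k (iter k (avg h) F) x = iter k (sdiff h) F x.
Proof.
elim: k x => [|k IH] x //; rewrite bdiffSr.
rewrite (@eq_bdiff _ _ _ (fun y => h%:R^-1 * (iter k (avg h) F y +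
    - 1 * iter k (avg h) F (y - h%:Z)))); last first.
  by move=> y _; rewrite iterS avg_diff /sdiff mulN1r.
by rewrite bdiffZ bdiffD bdiffZ bdiff_shift mulN1r !IH.
Qed.

Lemma iter_sdiff_le k h F x : (forall y, `|F y| <= 1) ->
  `|iter k (sdiff h) F x| <= (2 / h%:R) ^+ k.
Proof.
move=> F1; elim: k x => [|k IH] x /=; first by rewrite expr0.
have := IH x; have := IH (x - h%:Z); rewrite /sdiff normrM normfV normr_nat exprS.
set q := (2 / _) ^+ k; have -> : 2 / h%:R * q = h%:R^-1 * (2 * q) by ring.
move=> h1 h2; rewrite ler_wpM2l ?invr_ge0// (le_trans (ler_normB _ _))//; lra.
Qed.

(** Past k h all shifted copies of the jump equal 1 and cancel. *)
Lemma iter_sdiff_step_eq0 k h x : (0 < k)%N -> (x <= 0) || ((k * h)%N%:Z < x) ->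
  iter k (sdiff h) step x = 0.
Proof.
case: k => // k _; elim: k x => [|k IH] x hx.
  rewrite /= /sdiff /step; have [x0|x0] := leP x 0.
    by rewrite ltNge (_ : (x - _ <= 0) = true) ?subrr ?mulr0//; lia.
  by rewrite (_ : (0 < x - _) = true) ?subrr ?mulr0//; lia.
by rewrite iterS /sdiff !IH ?subrr ?mulr0//; lia.
Qed.

Definition ramp k h : int -> R := iter k (avg h) step.

Lemma ramp_bdiff_le k h x : (0 < k)%N ->
  `|bdiff k (ramp k h) x| <= (2 / h%:R) ^+ k * ((0 < x) && (x <= (k * h)%N%:Z))%:R.
Proof.
move=> k0; rewrite bdiff_iter_avg; case: (boolP (_ && _)) => hx; rewrite ?mulr1 ?mulr0.
  by apply: iter_sdiff_le => y; rewrite /step; case: ltP; rewrite ?normr1 ?normr0.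
by rewrite iter_sdiff_step_eq0 ?normr0//; lia.
Qed.

Lemma avg_ge0 h F x : (forall y, 0 <= F y) -> 0 <= avg h F x.
Proof. by move=> F0; rewrite mulr_ge0 ?invr_ge0// sumr_ge0. Qed.

Lemma avg_le1 h F x : (forall y, F y <= 1) -> avg h F x <= 1.
Proof.
move=> F1; case: h => [|h]; first by rewrite /avg big_ord0 mulr0.
rewrite /avg ler_pdivrMl ?ltr0n// mulr1.
apply: (@le_trans _ _ (\sum_(j < h.+1) 1)); first exact: ler_sum.
by rewrite sumr_const card_ord.
Qed.

Lemma ramp_ge0 k h x : 0 <= ramp k h x.
Proof. by elim: k x => [|k IH] x //=; apply: avg_ge0. Qed.

Lemma ramp_le1 k h x : ramp k h x <= 1.
Proof. by elim: k x => [|k IH] x /=; [rewrite /step; case: ltP|exact: avg_le1]. Qed.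

Lemma ramp_le0 k h x : x <= 0 -> ramp k h x = 0.
Proof.
elim: k x => [|k IH] x x0 /=; first by rewrite /ramp /= /step ltNge x0.
by rewrite /ramp /= /avg big1 ?mulr0// => j _; apply: IH; lia.
Qed.

Lemma ramp_eq1 k h x : (0 < h)%N -> (k * h.-1)%N%:Z < x -> ramp k h x = 1.
Proof.
move=> h0; elim: k x => [|k IH] x hx; first by rewrite /ramp /= /step hx.
rewrite /ramp /= /avg (eq_bigr (fun=> 1)).
  by rewrite sumr_const card_ord mulVf// pnatr_eq0 -lt0n.
by move=> j _; apply: IH; have := ltn_ord j; lia.
Qed.

End smoothing.

Section bump.
Context {R : realType}.
Variables (k L : nat).
Hypothesis k0 : (0 < k)%N.
Implicit Types (x y : int) (l n : nat).

Let K := (2 * k - 1)%N.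

Definition total_weight : R := \sum_(l < L.+1) (2 ^+ (2 * k - 1)) ^+ l.

Local Notation Z := total_weight.

(** The weights 2^(l(2k-1)) = (4^l)^(k-1/2) make this mixture of ramps grow
    like x^(k-1/2) until it reaches 1 at k 4^L. *)
Definition profile x : R :=
  Z^-1 * \sum_(l < L.+1) (2 ^+ (2 * k - 1)) ^+ l * ramp k (4 ^ l) x.

Lemma total_weight_bounds : (2 ^+ K) ^+ L <= Z <= 2 * (2 ^+ K) ^+ L.
Proof.
have b2 : (2 : R) <= 2 ^+ K by rewrite -[leLHS]expr1 ler_weXn2l ?ler1n// /K; lia.
rewrite /total_weight -/K; move: (2 ^+ K) b2 => b b2.
have b0 : 0 <= b by lra.
apply/andP; split.
  by rewrite big_ord_recr /= lerDr sumr_ge0// => l _; exact: exprn_ge0.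
elim: L => [|n IH]; first by rewrite big_ord_recl big_ord0 expr0; lra.
rewrite big_ord_recr /=; have := exprn_ge0 n b0; rewrite [b ^+ n.+1]exprS; nra.
Qed.

Lemma total_weight_gt0 : 0 < Z.
Proof.
by have /andP[+ _] := total_weight_bounds; apply: lt_le_trans; rewrite !exprn_gt0.
Qed.

Let Z0 := total_weight_gt0.
Let w0 l : 0 <= (2 ^+ (2 * k - 1)) ^+ l :> R. Proof. by rewrite !exprn_ge0. Qed.

Lemma profile_ge0 x : 0 <= profile x.
Proof.
rewrite mulr_ge0 ?invr_ge0 ?(ltW Z0)// sumr_ge0// => l _.
by rewrite mulr_ge0// ramp_ge0.
Qed.

Lemma profile_le1 x : profile x <= 1.
Proof.
rewrite /profile ler_pdivrMl// mulr1; apply: ler_sum => l _.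
by rewrite ler_piMr// ramp_le1.
Qed.

Lemma profile_le0 x : x <= 0 -> profile x = 0.
Proof. by move=> x0; rewrite /profile big1 ?mulr0// => l _; rewrite ramp_le0// mulr0. Qed.

Lemma profile_eq1 x : (k * 4 ^ L)%N%:Z <= x -> profile x = 1.
Proof.
move=> hx; rewrite /profile (eq_bigr (fun l : 'I_L.+1 => (2 ^+ (2 * k - 1)) ^+ l)).
  by rewrite mulVf// gt_eqF.
move=> l _; rewrite ramp_eq1 ?mulr1// ?expn_gt0//.
apply: lt_le_trans hx; rewrite ltz_nat ltn_pmul2l//.
have := ltn_ord l; rewrite ltnS => lL.
have := @leq_pexp2l 4 l L isT lL; have := expn_gt0 4 l; lia.
Qed.

(** The ramp at scale 4^l has reached 1 while d is still comparable to k 4^l.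
    The case l = 0 covers all 0 < d <= 4 k because averaging over one point
    leaves the jump unchanged. *)
Lemma dyadic_scale (d : nat) : (0 < d <= 4 * k * 4 ^ L)%N ->
  exists2 l : nat, (l <= L)%N & ramp k (4 ^ l) d%:Z = 1 :> R /\ (d <= 4 * k * 4 ^ l)%N.
Proof.
elim: L => [|n IH] /andP[d0 dL].
  by exists 0%N => //; split => //; apply: ramp_eq1 => //; rewrite expn0 muln0.
have [dk|dk] := leqP (k * 4 ^ n.+1) d.
  exists n.+1 => //; split => //; apply: ramp_eq1; first by rewrite expn_gt0.
  rewrite ltz_nat; apply: leq_trans dk; rewrite ltn_pmul2l// prednK ?expn_gt0//.
have [|l ln hl] := IH; first by rewrite d0 expnS in dk *; lia.
by exists l => //; apply: leqW.
Qed.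

(** Keep only the term of [profile] given by [dyadic_scale].  Squares avoid
    half-integral powers. *)
Lemma profile_lower (d : nat) : (0 < d <= 4 * k * 4 ^ L)%N ->
  4^-1 * (d%:R / (4 * k * 4 ^ L)%:R) ^+ K <= profile d%:Z ^+ 2.
Proof.
move=> /[dup] /andP[d0 _] /dyadic_scale[l lL [rl dl]].
have lL1 : (l < L.+1)%N by [].
have /andP[_ Zle] := total_weight_bounds.
have pl : 2^-1 * ((2 ^+ K) ^+ l / (2 ^+ K) ^+ L) <= profile d%:Z.
  rewrite /profile (bigD1 (Ordinal lL1))//= rl mulr1 mulrDr -[leLHS]addr0.
  apply: lerD.
    rewrite mulrCA mulrC ler_wpM2r// -invfM lef_pV2 ?posrE ?mulr_gt0 ?exprn_gt0//.
  by rewrite mulr_ge0 ?invr_ge0 ?(ltW Z0)// sumr_ge0// => i _; rewrite mulr_ge0// ramp_ge0.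
have : (2^-1 * ((2 ^+ K) ^+ l / (2 ^+ K) ^+ L)) ^+ 2 <= profile d%:Z ^+ 2.
  by rewrite ler_sqr ?nnegrE ?profile_ge0// mulr_ge0 ?invr_ge0// divr_ge0// !exprn_ge0.
apply: le_trans; rewrite [leRHS]exprMn exprVn.
have E4 i : ((2 ^+ K) ^+ i) ^+ 2 = (4 ^ i)%N%:R ^+ K :> R.
  rewrite natrX (_ : 4%:R = 2 ^+ 2); last by rewrite expr2 -natrM.
  by rewrite -!exprM; congr (_ ^+ _); lia.
have -> : (2 ^+ 2)^-1 = 4^-1 :> R by rewrite expr2 -natrM.
rewrite ler_wpM2l ?invr_ge0// [leRHS]expr_div_n !E4 -[leRHS]expr_div_n.
rewrite lerXn2r ?nnegrE ?divr_ge0// ler_pdivrMr ?ltr0n ?muln_gt0 ?k0 ?expn_gt0//.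
rewrite mulrAC ler_pdivlMr ?ltr0n ?expn_gt0// -!natrM ler_nat.
by rewrite mulnA leq_mul2r [(4 ^ l * _)%N]mulnC dl orbT.
Qed.

(** The square of a geometric sum is controlled by the sum of the squares, so
    that the dyadic scales add up without a further logarithmic factor.  The
    second conclusion is the induction companion of the first. *)
Lemma sum_geometric_sq_le n (e : nat -> R) : (forall l, 0 <= e l <= 1) ->
  (\sum_(l < n) 2 ^- l * e l) ^+ 2 <= 4 * \sum_(l < n) 4 ^- l * e l
  /\ \sum_(l < n) 2 ^- l * e l <= 2 - 2 * 2 ^- n.
Proof.
elim: n e => [|n IH] e e01.
  by rewrite !big_ord0 expr0n mulr0 lexx invr1 mulr1 subrr lexx.
have [IH1 IH2] := IH (fun l => e l.+1) (fun l => e01 l.+1).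
rewrite !big_ord_recl /= !expr0 invr1 !mul1r.
have -> : \sum_(i < n) 2 ^- bump 0 i * e (bump 0 i) =
    2^-1 * \sum_(i < n) 2 ^- i * e i.+1.
  by rewrite mulr_sumr; apply: eq_bigr => i _; rewrite /bump add1n exprS invfM mulrA.
have -> : \sum_(i < n) 4 ^- bump 0 i * e (bump 0 i) =
    4^-1 * \sum_(i < n) 4 ^- i * e i.+1.
  by rewrite mulr_sumr; apply: eq_bigr => i _; rewrite /bump add1n exprS invfM mulrA.
have X0 : 0 <= \sum_(i < n) 2 ^- i * e i.+1.
  by apply: sumr_ge0 => i _; rewrite mulr_ge0 ?invr_ge0 ?exprn_ge0//; have /andP[] := e01 i.+1.
have p0 : 0 <= 2 ^- n :> R by rewrite invr_ge0 exprn_ge0.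
have -> : 2 ^- n.+1 = 2^-1 * 2 ^- n :> R by rewrite exprS invfM.
move: (\sum_(i < n) _) (\sum_(i < n) _) (2 ^- n) IH1 IH2 X0 p0 => X Y p IH1 IH2 X0 p0.
have /andP[a0 a1] := e01 0%N; move: (e 0%N) a0 a1 => a a0 a1; split; last by lra.
nra.
Qed.

(** At scale 4^l the weight 2^(l(2k-1)) meets differences of size (2/4^l)^k:
    the product is 2^k 2^-l. *)
Lemma bdiff_profile_sq_le x :
  bdiff k profile x ^+ 2 <= 4 ^+ k.+1 / Z ^+ 2 *
    \sum_(l < L.+1) 4 ^- l * ((0 < x) && (x <= (k * 4 ^ l)%N%:Z))%:R.
Proof.
pose e l : R := ((0 < x) && (x <= (k * 4 ^ l)%N%:Z))%:R.
have e01 l : 0 <= e l <= 1 by rewrite /e ler0n lern1 leq_b1.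
have [sq _] := sum_geometric_sq_le L.+1 e01.
have Eb : bdiff k profile x = Z^-1 * \sum_(l < L.+1)
    (2 ^+ (2 * k - 1)) ^+ l * bdiff k (ramp k (4 ^ l)) x.
  rewrite /profile bdiffZ bdiff_sum; congr (_ * _); apply: eq_bigr => l _.
  exact: bdiffZ.
have ab : `|bdiff k profile x| <= 2 ^+ k / Z * \sum_(l < L.+1) 2 ^- l * e l.
  rewrite Eb normrM ger0_norm ?invr_ge0 ?(ltW Z0)// mulrAC mulrC.
  rewrite ler_wpM2r ?invr_ge0 ?(ltW Z0)//.
  apply: (le_trans (ler_norm_sum _ _ _)); rewrite mulr_sumr; apply: ler_sum => l _.
  rewrite normrM ger0_norm//.
  apply: (le_trans (ler_wpM2l (w0 _) (ramp_bdiff_le (4 ^ l) x k0))).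
  rewrite !mulrA ler_wpM2r//.
  rewrite natrX expr_div_n [_ ^+ l]exprAC mulrCA ler_wpM2l ?exprn_ge0//.
  rewrite -!exprM mulnC.
  rewrite ler_pdivrMr ?exprn_gt0//.
  rewrite (_ : 4%:R = 2 ^+ 2); last by rewrite expr2 -natrM.
  rewrite -exprM mulrC ler_pdivlMr ?exprn_gt0// -exprD.
  by rewrite (_ : (_ + _ = 2 * (l * k))%N)//; lia.
have S0 : 0 <= \sum_(l < L.+1) 2 ^- l * e l.
  by apply: sumr_ge0 => i _; rewrite mulr_ge0 ?invr_ge0 ?exprn_ge0//; have /andP[] := e01 i.
rewrite -real_normK ?num_real//.
apply: (@le_trans _ _ ((2 ^+ k / Z * \sum_(l < L.+1) 2 ^- l * e l) ^+ 2)).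
  by rewrite ler_sqr ?nnegrE// mulr_ge0// divr_ge0 ?exprn_ge0// ltW.
rewrite exprMn; apply: (le_trans (ler_wpM2l (sqr_ge0 _) sq)).
rewrite mulrA ler_wpM2r//.
  by apply: sumr_ge0 => i _; rewrite mulr_ge0 ?invr_ge0 ?exprn_ge0//; have /andP[] := e01 i.
rewrite expr_div_n mulrAC ler_wpM2r ?invr_ge0 ?sqr_ge0//.
rewrite [4 ^+ k.+1]exprSr -exprM mulnC exprM.
by rewrite (_ : 2 ^+ 2 = 4)// expr2 -natrM.
Qed.

(** A bump equal to 1 at 0 and supported in a ball of radius k 4^L.  Since
    [profile] vanishes on the nonpositive side together with the differences
    there, the two one-sided profiles can be added without a kink at 0. *)
Definition hat x : R := 1 - profile x - profile (- x).

Lemma hat0 : hat 0 = 1.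
Proof. by rewrite /hat oppr0 profile_le0// !subr0. Qed.

Lemma hatE x : hat x = 1 - profile `|x|%N%:Z.
Proof.
rewrite /hat; have [x0|x0] := leP x 0.
  by rewrite profile_le0// subr0; congr (_ - profile _); lia.
rewrite [profile (- x)]profile_le0 ?subr0; last by lia.
by congr (_ - profile _); lia.
Qed.

Lemma hat_ge0 x : 0 <= hat x.
Proof. by rewrite hatE subr_ge0 profile_le1. Qed.

Lemma hat_eq0 x : (k * 4 ^ L <= `|x|)%N -> hat x = 0.
Proof. by move=> hx; rewrite hatE profile_eq1 ?subrr. Qed.

Lemma bdiff_hat_eq0 x : (x <= - (k * 4 ^ L)%N%:Z) || ((k * 4 ^ L + k)%N%:Z <= x) ->
  bdiff k hat x = 0.
Proof. by move=> hx; apply: bdiff0 => y hy; apply: hat_eq0; lia. Qed.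

Lemma sum_indicator_le n (p : 'I_n -> bool) (a b N : nat) :
  (forall c, p c -> (a <= c < b)%N) -> (b - a <= N)%N ->
  \sum_(c < n) (p c)%:R <= N%:R :> R.
Proof.
move=> pab abN; rewrite -natr_sum ler_nat; apply: leq_trans abN.
apply: leq_trans (card_ord_itv n a b); rewrite [leqRHS]big_mkcond/=.
by apply: leq_sum => c _; case: (boolP (p c)) => // /pab ->.
Qed.

(** Each of the L + 1 scales contributes the same amount: 4^-l times the
    k 4^l points where its differences live, for each of the two sides. *)
Lemma hat_energy n (t : nat) :
  \sum_(c < n) bdiff k hat ((c : nat)%:Z - t%:Z) ^+ 2 <=
    4 ^+ k.+2 * k%:R * L.+1%:R / 4 ^+ (K * L).
Proof.
pose e l x : R := ((0 < x) && (x <= (k * 4 ^ l)%N%:Z))%:R.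
pose q := 4 ^+ k.+1 / Z ^+ 2.
have q0 : 0 <= q by rewrite divr_ge0 ?exprn_ge0// ltW.
have sq x : bdiff k hat x ^+ 2 <=
    2 * q * \sum_(l < L.+1) 4 ^- l * (e l x + e l (k%:Z - x)).
  have -> : bdiff k hat x = - (bdiff k profile x) -
      (- 1) ^+ k * bdiff k profile (k%:Z - x).
    rewrite (@eq_bdiff _ _ _ (fun y => 1 + (- 1 * profile y +
      - 1 * profile (- y)))); last by move=> y _; rewrite /hat; ring.
    rewrite bdiffD (bdiffD _ (fun y => - 1 * profile y)) (bdiffZ _ _ profile).
    rewrite (bdiffZ _ _ (fun y => profile (- y))) (bdiff_opp _ profile).
    rewrite (_ : bdiff k (fun=> 1) x = 0); first by ring.
    by rewrite -(prednK k0) bdiffSr bdiff0// => y _; rewrite subrr.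
  under eq_bigr do rewrite mulrDr; rewrite big_split /=.
  have := bdiff_profile_sq_le x; have := bdiff_profile_sq_le (k%:Z - x).
  rewrite -/q -/(e _ _); set u := bdiff _ _ _; set v := bdiff _ _ _.
  set su := \sum_(l < _) _; set sv := \sum_(l < _) _ => hu hv.
  have : (- v - (- 1) ^+ k * u) ^+ 2 <= 2 * v ^+ 2 + 2 * u ^+ 2.
    have : ((- 1) ^+ k * u) ^+ 2 = u ^+ 2 by rewrite exprMn sqrr_sign mul1r.
    move: ((- 1) ^+ k * u) => u' <-; have := sqr_ge0 (v - u'); nra.
  move: q0 hu hv; clear; move=> q0 hu hv h; nra.
apply: (le_trans (ler_sum _ (fun c _ => sq _))); rewrite -mulr_sumr exchange_big /=.
have hs : \sum_(l < L.+1) \sum_(c < n) 4 ^- l *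
     (e l (c%:Z - t%:Z) + e l (k%:Z - (c%:Z - t%:Z))) <= 2 * k%:R * L.+1%:R.
  apply: (@le_trans _ _ (\sum_(l < L.+1) 2 * k%:R)); last first.
    by rewrite sumr_const card_ord -[leLHS]mulr_natr.
  apply: ler_sum => l _; rewrite -mulr_sumr big_split /= ler_pdivrMl ?exprn_gt0//.
  have -> : 4 ^+ l * (2 * k%:R) = (k * 4 ^ l)%:R + (k * 4 ^ l)%:R :> R.
    by rewrite natrM natrX; ring.
  apply: lerD.
    by apply: (@sum_indicator_le _ _ t.+1 (t + (k * 4 ^ l)).+1) => [c|]; lia.
  by apply: (@sum_indicator_le _ _ (t + k - k * 4 ^ l) (t + k)) => [c|]; lia.
apply: (le_trans (ler_wpM2l _ hs)); first by rewrite mulr_ge0.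
have /andP[Zge _] := total_weight_bounds.
have Zsq : 4 ^+ (K * L) <= Z ^+ 2.
  have -> : 4 ^+ (K * L) = ((2 ^+ K) ^+ L) ^+ 2 :> R.
    by rewrite (_ : 4 = 2 ^+ 2) -?exprM; [congr (_ ^+ _); lia|rewrite expr2 -natrM].
  by rewrite ler_sqr ?nnegrE ?exprn_ge0// ltW.
have Zi : (Z ^+ 2)^-1 <= (4 ^+ (K * L))^-1.
  by rewrite lef_pV2 ?posrE ?exprn_gt0.
rewrite /q; have -> : 2 * (4 ^+ k.+1 / Z ^+ 2) * (2 * k%:R * L.+1%:R) =
   4 ^+ k.+2 * k%:R * L.+1%:R / Z ^+ 2 by rewrite [4 ^+ k.+2]exprS; ring.
by apply: ler_wpM2l => //; rewrite !mulr_ge0// exprn_ge0.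
Qed.

End bump.

(** * Gaps between knots *)

Section knots.
Variables (k n : nat) (S : {set 'I_(n - k)}).
Local Notation s := #|S|.
Local Notation knot i := (nth 0%N (knots S) i).

Lemma knot_mem t : t \in S ->
  exists2 i, (0 < i <= s)%N & knot i = (k + nat_of_ord t).+1.
Proof.
move=> tS; have iS : (index t (enum S) < size (enum S))%N.
  by rewrite index_mem mem_enum.
exists (index t (enum S)).+1; first by rewrite cardE.
by rewrite /= nth_rcons size_map iS (nth_map t)// nth_index// mem_enum.
Qed.

Lemma knot_inner i : (0 < i <= s)%N ->
  exists2 t, t \in S & knot i = (k + nat_of_ord t).+1.
Proof.
case: i => //= i; rewrite cardE => iS.
have [t0 _] : exists t : 'I_(n - k), t \in S.
  by apply/card_gt0P; rewrite cardE (leq_ltn_trans _ iS).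
exists (nth t0 (enum S) i); first by rewrite -mem_enum mem_nth.
by rewrite nth_rcons size_map iS (nth_map t0).
Qed.

Lemma knot_last : knot s.+1 = n.+1.
Proof. by rewrite /= nth_rcons size_map -cardE ltnn eqxx. Qed.

Lemma knots_sorted : (k <= n)%N -> sorted ltn (knots S).
Proof.
move=> kn; rewrite /knots /= rcons_path; apply/andP; split.
  have : sorted ltn [seq nat_of_ord r | r <- enum S].
    have -> : enum S = [seq r <- enum 'I_(n - k) | r \in S] by rewrite enumT.
    have tr : transitive (relpre (@nat_of_ord (n - k)) ltn).
      by move=> x y z; exact: ltn_trans.
    rewrite sorted_map; apply: (sorted_filter tr).
    by have := iota_ltn_sorted 0 (n - k); rewrite -val_enum_ord sorted_map.
  case: (enum S) => //= a e h; rewrite ltnS leq_addr /=.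
  rewrite (@path_map _ _ (fun r : 'I_(n - k) => (k + r).+1) ltn).
  by move: h; rewrite path_map; apply: sub_path => x y /=; rewrite ltnS ltn_add2l.
case/lastP: (enum S) => [|e a]; first by rewrite /= ltnS.
by rewrite map_rcons last_rcons; have := ltn_ord a; lia.
Qed.

Lemma ltn_knot i j : (k <= n)%N -> (i < j <= s.+1)%N -> (knot i < knot j)%N.
Proof.
move=> kn /andP[ij js].
have sz : size (knots S) = s.+2 by rewrite /= size_rcons size_map cardE.
by rewrite (sorted_ltn_nth ltn_trans)// ?knots_sorted// inE sz; lia.
Qed.

Lemma gap_minmax i : (0 < i <= s.+1)%N -> (gap_min S <= gap S i <= gap_max S)%N.
Proof.
move=> hi; apply/andP; split.
  rewrite /gap_min; have : i \in index_iota 1 s.+2 by rewrite mem_index_iota; lia.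
  elim: (index_iota _ _) => // a r IH; rewrite inE big_cons => /predU1P[->|/IH].
    exact: geq_minl.
  by apply: leq_trans; exact: geq_minr.
by rewrite /gap_max; apply: leq_bigmax_seq => //; rewrite mem_index_iota; lia.
Qed.

Lemma le_gap_min c : (forall i, (1 <= i <= s.+1)%N -> (c <= gap S i)%N) ->
  (c <= gap_min S)%N.
Proof.
move=> hc; rewrite /gap_min big_seq; elim/big_ind : _; first by apply: hc.
  by move=> x y cx cy; rewrite leq_min cx.
by move=> i; rewrite mem_index_iota => hi; apply: hc; lia.
Qed.

Lemma knot_separation i j : (k <= n)%N -> (i < j <= s.+1)%N ->
  (gap_min S <= knot j - knot i)%N.
Proof.
move=> kn /andP[ij js]; have /andP[+ _] : (gap_min S <= gap S i.+1 <= gap_max S)%N.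
  by apply: gap_minmax; lia.
move=> /leq_trans; apply; rewrite /gap leq_sub2r//.
have [->|ij'] := eqVneq i.+1 j; first by [].
by apply/ltnW/ltn_knot => //; lia.
Qed.

Lemma separation t t' : t \in S -> t' \in S -> (t < t')%N ->
  (gap_min S <= t' - t)%N.
Proof.
move=> tS t'S tt'; have kn : (k <= n)%N by have := ltn_ord t; lia.
have [i hi Ei] := knot_mem tS; have [j hj Ej] := knot_mem t'S.
have ij : (i < j)%N.
  rewrite ltnNge leq_eqVlt; apply/negP => /predU1P[E|ji].
    by move: Ei; rewrite -E Ej; lia.
  by have := @ltn_knot j i kn ltac:(lia); rewrite Ei Ej; lia.
have := @knot_separation i j kn ltac:(lia); rewrite Ei Ej; lia.
Qed.

Lemma separation_left t : t \in S -> (gap_min S <= t.+1)%N.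
Proof.
move=> tS; have kn : (k <= n)%N by have := ltn_ord t; lia.
have [i hi Ei] := knot_mem tS.
by have := @knot_separation 0%N i kn ltac:(lia); rewrite Ei /=; lia.
Qed.

Lemma separation_right t : t \in S -> (gap_min S <= n - k - t)%N.
Proof.
move=> tS; have kn : (k <= n)%N by have := ltn_ord t; lia.
have [i hi Ei] := knot_mem tS.
by have := @knot_separation i s.+1 kn ltac:(lia); rewrite Ei knot_last /=; lia.
Qed.

Lemma sum_gap : (k <= n)%N -> (\sum_(1 <= i < s.+2) gap S i = n.+1 - k)%N.
Proof.
move=> kn; have : forall m, (m <= s.+1)%N ->
    (\sum_(1 <= i < m.+1) gap S i + k = knot m)%N.
  elim=> [|m IH] ms; first by rewrite big_geq.
  rewrite big_nat_recr//= addnAC IH; last by lia.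
  by have := @ltn_knot m m.+1 kn ltac:(lia); rewrite /gap /=; lia.
by move=> /(_ s.+1 (leqnn _)); rewrite knot_last; lia.
Qed.

Lemma gap_min_mul : (k <= n)%N -> (gap_min S * s.+1 <= n.+1 - k)%N.
Proof.
move=> kn; rewrite -sum_gap// -[s.+1]/(s.+2 - 1)%N mulnC -sum_nat_const_nat.
rewrite big_seq [leqRHS]big_seq; apply: leq_sum => i; rewrite mem_index_iota => hi.
by have /andP[] := @gap_minmax i ltac:(lia).
Qed.

Lemma gap_max_mul : (k <= n)%N -> (n.+1 - k <= gap_max S * s.+1)%N.
Proof.
move=> kn; rewrite -sum_gap// -[s.+1]/(s.+2 - 1)%N mulnC -sum_nat_const_nat.
rewrite big_seq [leqRHS]big_seq; apply: leq_sum => i; rewrite mem_index_iota => hi.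
by have /andP[] := @gap_minmax i ltac:(lia).
Qed.

(** Every row is within the largest gap of a knot, unless there is no knot;
    then the only gap is n + 1 - k. *)
Lemma knot_near (r : 'I_(n - k)) :
  (exists2 t, t \in S & (`|r - t| <= gap_max S)%N) \/ (n.+1 - k <= gap_max S)%N.
Proof.
have kn : (k <= n)%N by have := ltn_ord r; lia.
have ex : exists i, ((k + r).+1 <= knot i)%N.
  by exists s.+1; rewrite knot_last; have := ltn_ord r; lia.
case: (ex_minnP ex) => i hi imin.
have is_ : (i <= s.+1)%N.
  by apply: imin; rewrite knot_last; have := ltn_ord r; lia.
have i0 : (0 < i)%N by case: i hi {imin is_} => //=; lia.
have hp : (knot i.-1 < (k + r).+1)%N.
  by rewrite ltnNge; apply/negP => /imin; lia.
have /andP[_ gi] := @gap_minmax i ltac:(lia).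
rewrite /gap in gi.
have [ils|sli] := leqP i s.
  have [t tS Et] := @knot_inner i ltac:(lia).
  by left; exists t => //; rewrite Et in hi gi; lia.
have [i1|i1] := eqVneq i 1%N.
  right; have E : i = s.+1 by lia.
  by move: gi; rewrite {1}E knot_last i1 /=; lia.
have [t tS Et] := @knot_inner i.-1 ltac:(lia).
by left; exists t => //; rewrite Et in hp gi; lia.
Qed.

End knots.

(** * Interpolating the signs at the knots *)

Section interpolation.
Context {R : realType}.

Lemma sum_at_most_one (I : finType) (P : pred I) (F : I -> R) :
  (forall i j, P i -> P j -> F i != 0 -> F j != 0 -> i = j) ->
  \sum_(i | P i) F i = 0 \/
  exists i, [/\ P i, F i != 0 & \sum_(i | P i) F i = F i].
Proof.
move=> uniq; have [/existsP[i /andP[Pi Fi]]|/existsPn F0] :=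
  boolP [exists i, P i && (F i != 0)].
  right; exists i; split => //; rewrite (bigD1 i)//= big1 ?addr0// => j /andP[Pj ji].
  by apply: contraNeq ji => Fj; rewrite (uniq j i).
left; apply: big1 => i Pi; have := F0 i; rewrite Pi negbK => /eqP//.
Qed.

Lemma sum_at_most_one_sq (I : finType) (P : pred I) (F : I -> R) :
  (forall i j, P i -> P j -> F i != 0 -> F j != 0 -> i = j) ->
  (\sum_(i | P i) F i) ^+ 2 <= \sum_(i | P i) F i ^+ 2.
Proof.
move=> /sum_at_most_one[->|[i [Pi _ ->]]].
  by rewrite expr0n sumr_ge0// => i _; exact: sqr_ge0.
by rewrite [leRHS](bigD1 i)//= lerDl sumr_ge0// => j _; exact: sqr_ge0.
Qed.

(** The bound of [hat_energy] for the differences of a single hat. *)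
Definition energy k L : R := 4 ^+ k.+2 * k%:R * L.+1%:R / 4 ^+ ((2 * k - 1) * L).

(** A sum of signed hats centred at the knots.  The separation makes both the
    hats and their differences (which spread over k further points)
    disjointly supported, so 1 - |q_r| is governed by a single knot and the
    energies add up. *)
Lemma interpolating_vector k n L (S : {set 'I_(n - k)}) (s : 'I_(n - k) -> R) :
  (0 < k)%N -> (3 * (k * 4 ^ L) <= gap_min S)%N -> (forall r, `|s r| <= 1) ->
  exists q : 'cV[R]_(n - k), [/\ forall r, r \in S -> q r 0 = s r,
      forall r, q r 0 = 0 \/ exists t, [/\ t \in S, (`|r - t| < k * 4 ^ L)%N &
        `|q r 0| <= 1 - profile k L `|r - t|%N%:Z] &
      \sum_i ((Delta R k n)^T *m q) i 0 ^+ 2 <= #|S|%:R * energy k L].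
Proof.
move=> k0 sep s1; set M := (k * 4 ^ L)%N in sep *.
have Mk : (k <= M)%N by rewrite leq_pmulr// expn_gt0.
pose b (t : 'I_(n - k)) (x : int) : R := hat k L (x - (t : nat)%:Z).
pose G (x : int) := \sum_(t in S) s t * b t x.
have sepS (t t' : 'I_(n - k)) : t \in S -> t' \in S -> (`|t - t'| < 3 * M)%N -> t = t'.
  move=> tS t'S tt'; apply/val_inj/eqP; rewrite /= eqn_leq.
  apply/andP; split; rewrite leqNgt; apply/negP => lt_tt.
    by have := separation t'S tS lt_tt; lia.
  by have := separation tS t'S lt_tt; lia.
have bN0 (t : 'I_(n - k)) x : b t x != 0 -> (`|x - (t : nat)%:Z| < M)%N.
  by apply: contraNT; rewrite -leqNgt => h; rewrite /b hat_eq0.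
have one x t t' : t \in S -> t' \in S -> s t * b t x != 0 -> s t' * b t' x != 0 -> t = t'.
  move=> tS t'S; rewrite !mulf_eq0 !negb_or => /andP[_ /bN0 h] /andP[_ /bN0 h'].
  by apply: sepS => //; lia.
exists (\col_r G (r : nat)%:Z); split.
- move=> r rS; rewrite mxE /G (bigD1 r)//= big1 ?addr0.
    by rewrite /b subrr hat0 ?mulr1.
  move=> t /andP[tS tr]; rewrite /b hat_eq0 ?mulr0//.
  rewrite leqNgt; apply: contra tr => h; apply/eqP; apply: sepS => //; lia.
- move=> r; rewrite mxE; have [G0|[t [tS tN0 Et]]] := sum_at_most_one (one (r : nat)%:Z).
    by left; rewrite /G G0.
  right; exists t; split => //.
    by move: tN0; rewrite mulf_eq0 negb_or => /andP[_ /bN0]; lia.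
  rewrite /G Et normrM; have b0 : 0 <= b t r by exact: hat_ge0.
  rewrite (ger0_norm b0) (le_trans (ler_piMl b0 (s1 t)))//.
  by rewrite /b hatE.
- under eq_bigr => c _.
    rewrite (@Delta_trmx_mulmx _ _ _ _ G); first last.
    + move=> x hx; rewrite /G big1// => t tS; rewrite /b hat_eq0 ?mulr0//.
      by have := separation_left tS; have := separation_right tS; lia.
    + by move=> r; rewrite mxE.
    rewrite exprMn sqrr_sign mul1r /G bdiff_sum.
    under eq_bigr => t _ do rewrite bdiffZ (bdiff_shift k (hat k L)).
    over.
  apply: (@le_trans _ _ (\sum_(c < n) \sum_(t in S)
      bdiff k (hat k L) ((c : nat)%:Z - (t : nat)%:Z) ^+ 2)).
    apply: ler_sum => c _; apply: le_trans (sum_at_most_one_sq _) _ => [t t' tS t'S|].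
      rewrite !mulf_eq0 !negb_or => /andP[_ h] /andP[_ h'].
      have hM (u : int) : bdiff k (hat k L : int -> R) ((c : nat)%:Z - u) != 0 ->
          (- M%:Z < c%:Z - u) && (c%:Z - u < (M + k)%N%:Z).
        by apply: contraNT => hu; apply/eqP/bdiff_hat_eq0 => //; lia.
      by have := hM _ h; have := hM _ h'; move=> *; apply: sepS => //; lia.
    apply: ler_sum => t _; rewrite exprMn ler_piMl ?sqr_ge0//.
    by rewrite -real_normK ?num_real// expr_le1.
  rewrite exchange_big /= mulr_natl -sumr_const; apply: ler_sum => t _.
  exact: hat_energy.
Qed.

(** The deterministic part, for fixed n: the linear forms V collect those
    giving w and those giving Q e.  The first calibration condition handles the
    rows where the interpolating vector vanishes, where only the bound by the
    largest gap is available; the second one handles the rows close to a knot,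
    through [profile_lower]. *)
Lemma fast_rate k n L (S : {set 'I_(n - k)}) (lambda c : R) :
  (0 < k <= n)%N -> (3 * (k * 4 ^ L) <= gap_min S)%N -> 0 < lambda -> 0 <= c ->
  c * (gap_max S)%:R ^+ (2 * k - 1) <= (n%:R * lambda) ^+ 2 ->
  4 * c * (4 * k * 4 ^ L)%:R ^+ (2 * k - 1) <= (n%:R * lambda) ^+ 2 ->
  exists V : 'I_(n - k + n) -> 'I_n -> R, forall y f0 f : 'cV[R]_n,
    (forall j, (\sum_i V j i * (y i 0 - f0 i 0)) ^+ 2 <= c * \sum_i V j i ^+ 2) ->
    sqnorm_n (estimator k lambda y - f0) <=
      sqnorm_n (f - f0) + 4 * lambda * norm1_off S f +
      (4 * n%:R^-1 * (c * (k * #|S|.+1)%:R) +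
       4 * n%:R * lambda ^+ 2 * (#|S|%:R * energy k L)).
Proof.
move=> /[dup] kn /andP[k0 kn'] sep l0 c0 cmax cmin.
have n0 : (0 < n)%N by lia.
have [a [Q [dec aS near far trQ]]] := @noise_splitting R k n S kn.
exists (fun j i => match fintype.split j with inl r => a i r | inr l => Q l i end).
move=> y f0 f hV.
have hw r : ((a^T *m (y - f0)) r 0) ^+ 2 <= c * \sum_i a i r ^+ 2.
  have -> : (a^T *m (y - f0)) r 0 = \sum_i a i r * (y i 0 - f0 i 0).
    by rewrite mxE; apply: eq_bigr => i _; rewrite !mxE.
  by have := hV (lshift n r); rewrite (unsplitK (inl r)).
have hQ l : ((Q *m (y - f0)) l 0) ^+ 2 <= c * \sum_i Q l i ^+ 2.
  have -> : (Q *m (y - f0)) l 0 = \sum_i Q l i * (y i 0 - f0 i 0).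
    by rewrite mxE; apply: eq_bigr => i _; rewrite !mxE.
  by have := hV (rshift (n - k) l); rewrite (unsplitK (inr l)).
have amax r : \sum_i a i r ^+ 2 <= (gap_max S)%:R ^+ (2 * k - 1).
  have [[t tS rt]|nk] := knot_near S r.
    by rewrite (le_trans (near r t tS))// lerXn2r ?nnegrE// ler_nat.
  by rewrite (le_trans (far r))// lerXn2r ?nnegrE// ler_nat; lia.
have nl0 : 0 <= n%:R * lambda by rewrite mulr_ge0// ltW.
have := @oracle_inequality R k n lambda (#|S|%:R * energy k L) S y f0 f
  (Q *m (y - f0)) (a^T *m (y - f0)) n0 l0 (dec _) _ _.
move=> /(_ _ _)/le_trans; apply.
- move=> r rS; rewrite mxE big1// => i _; rewrite mxE aS ?mul0r//.
- move=> s s1; have [q [qS qr qE]] := interpolating_vector k0 sep s1.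
  exists q; split => // r rS.
  have [->|[t [tS rt qt]]] := qr r.
    rewrite normr0 subr0 mulr1 -ler_sqr ?nnegrE// real_normK ?num_real//.
    by rewrite (le_trans (hw r))// (le_trans _ cmax)// ler_wpM2l.
  apply: (@le_trans _ _ (n%:R * lambda * profile k L `|r - t|%N%:Z)); last first.
    by rewrite ler_wpM2l//; lra.
  rewrite -ler_sqr ?nnegrE ?(mulr_ge0 nl0) ?profile_ge0// real_normK ?num_real//.
  rewrite (le_trans (hw r))// exprMn.
  have rt0 : (0 < `|r - t|)%N.
    rewrite absz_gt0 subr_eq0; apply: contra rS => /eqP/=[E].
    by rewrite (val_inj E : r = t).
  have pl := @profile_lower R k L k0 `|r - t|%N.
  apply: (@le_trans _ _ (c * `|r - t|%N%:R ^+ (2 * k - 1))); first by rewrite ler_wpM2l// near.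
  apply: (@le_trans _ _ ((n%:R * lambda) ^+ 2 *
      (4^-1 * (`|r - t|%N%:R / (4 * k * 4 ^ L)%:R) ^+ (2 * k - 1)))); last first.
    by rewrite ler_wpM2l ?sqr_ge0// pl//; lia.
  rewrite expr_div_n; move: cmin; set D := (4 * k * 4 ^ L)%:R ^+ _; set X := _ ^+ (2 * k - 1).
  have D0 : 0 < D by rewrite exprn_gt0// ltr0n !muln_gt0 k0 expn_gt0.
  have X0 : 0 <= X by exact: exprn_ge0.
  move=> /(ler_wpM2r (mulr_ge0 X0 (ltW (divr_gt0 ltr01 D0)))) h.
  have h4 : 4^-1 * (4 * c * D * (X * (1 / D))) = c * X by field; rewrite gt_eqF.
  have : 4^-1 * (4 * c * D * (X * (1 / D))) <=
      4^-1 * ((n%:R * lambda) ^+ 2 * (X * (1 / D))).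
    by apply: ler_wpM2l h; rewrite invr_ge0.
  by rewrite h4 mul1r [X in _ <= X]mulrCA.
apply: lerD => //; rewrite lerD2r ler_wpM2l ?mulr_ge0 ?invr_ge0//.
rewrite (le_trans (ler_sum _ (fun l _ => hQ l)))// -mulr_sumr ler_wpM2l//.
Qed.

End interpolation.

(** * Calibration of the tuning parameter *)

Section calibration.
Context {R : realType}.

(** Source of the numerical lower bounds on ln 4 and on the logarithm of a
    number at least 3. *)
Lemma ln_lower (x : R) : 0 < x -> 1 - x^-1 <= ln x.
Proof.
move=> x0; have := @le_ln1Dx R (x^-1 - 1); rewrite ltrBrDr addrC subrr invr_gt0 x0.
by move=> /(_ isT); rewrite addrC subrK lnV//; lra.
Qed.

Lemma lambda_order_gt0 k n s : (1 < n)%N -> 0 < lambda_order R k n s.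
Proof.
move=> n1; have nR : 1 < n%:R :> R by rewrite ltr1n.
rewrite /lambda_order !mulr_gt0 ?exprn_gt0 ?powR_gt0 ?divr_gt0 ?sqrtr_gt0 ?divr_gt0//; try lra.
by rewrite ln_gt0.
Qed.

(** The form in which the order of lambda is used: n lambda is the typical
    size of w_r at the middle of a gap of length n / (s + 1), up to
    the logarithm. *)
Lemma lambda_order_sq k n s : (0 < k)%N -> (1 < n)%N ->
  (n%:R * lambda_order R k n s) ^+ 2 =
  (n%:R / s.+1%:R) ^+ (2 * k - 1) * ln n%:R.
Proof.
case: k => // k _ n1; have nR : 1 < n%:R :> R by rewrite ltr1n.
have lnn : 0 <= ln n%:R :> R by rewrite ln_ge0// ltW.
rewrite /lambda_order !exprMn /= sqr_sqrtr ?divr_ge0//.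
have s0 : 0 < 1 / s.+1%:R :> R by rewrite divr_gt0.
have -> : ((1 / s.+1%:R) `^ ((2 * k.+1%:R - 1) / 2)) ^+ 2 =
    (1 / s.+1%:R) ^+ (2 * k.+1 - 1) :> R.
  rewrite expr2 -powRD; last by rewrite (gt_eqF s0) implybT.
  rewrite -powR_mulrn ?(ltW s0)//; congr (_ `^ _).
  rewrite natrB; last by lia.
  by rewrite natrM; field.
have -> : (2 * k.+1 - 1 = (2 * k).+1)%N by lia.
rewrite div1r !exprVn -exprM [(k * 2)%N]mulnC.
rewrite [n%:R ^+ (2 * k).+1]exprS.
have : s.+1%:R ^+ (2 * k).+1 != 0 :> R by rewrite expf_eq0 pnatr_eq0.
move: (s.+1%:R ^+ (2 * k).+1) (n%:R ^+ (2 * k)) => a b a0.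
by field; rewrite a0 /= gt_eqF//; lra.
Qed.

(** The factor 3 leaves room for two hats and the k extra points of their
    differences between consecutive knots. *)
Lemma dyadic_radius k g : (0 < k)%N -> (3 * k <= g)%N ->
  exists L, (3 * (k * 4 ^ L) <= g < 12 * (k * 4 ^ L))%N.
Proof.
move=> k0 kg; have g0 : (0 < g %/ (3 * k))%N by rewrite divn_gt0; lia.
exists (trunc_log 4 (g %/ (3 * k))).
have /andP[h1 h2] := @trunc_log_bounds 4 _ isT g0.
move: h1 h2; set L := trunc_log _ _.
rewrite leq_divRL ?ltn_divLR; try lia.
by rewrite expnS => h1 h2; lia.
Qed.

(** Large enough for both calibration conditions of [fast_rate], when kappa
    bounds the ratio of the largest gap to the smallest. *)
Definition calibration k (kappa : R) : R := 4 * (2 * kappa) ^+ k.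

Definition remainder_constant k (kappa : R) : R :=
  24 * k%:R + 12 * calibration k kappa ^+ 2 * (24 * k%:R * kappa) ^+ (2 * k - 1) *
     (4 ^+ k.+2 * k%:R).

(** With rho = n / (s + 1), one has
    gap_min <= rho <= 2 gap_max <= 2 kappa gap_min, and 4^L, gap_min, gap_max and
    rho agree up to constants depending on k and kappa.  The number L + 1 of
    scales contributes the factor log rho. *)
Lemma fast_rate_calibrated k n (S : {set 'I_(n - k)}) (kappa : R) :
  (0 < k <= n)%N -> (3 * k <= gap_min S)%N -> 1 <= kappa ->
  (gap_max S)%:R <= kappa * (gap_min S)%:R ->
  let lambda := calibration k kappa * lambda_order R k n #|S| in
  0 < remainder_order R n #|S| /\
  exists V : 'I_(n - k + n) -> 'I_n -> R, forall y f0 f : 'cV[R]_n,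
    (forall j, (\sum_i V j i * (y i 0 - f0 i 0)) ^+ 2 <=
       4 * ln n%:R * \sum_i V j i ^+ 2) ->
    sqnorm_n (estimator k lambda y - f0) <=
      sqnorm_n (f - f0) + 4 * lambda * norm1_off S f +
      remainder_constant k kappa * remainder_order R n #|S|.
Proof.
move=> /[dup] kn /andP[k0 kn'] kg kappa1 gkappa lambda.
have kappa0 : 0 <= kappa by lra.
have kappa2 : 1 <= 2 * kappa by lra.
have kappa20 : 0 <= 2 * kappa by lra.
have gmul := gap_min_mul S kn'; have gMul := gap_max_mul S kn'.
have n1 : (1 < n)%N by nia.
have nR : 1 < n%:R :> R by rewrite ltr1n.
have n0 : 0 < n%:R :> R by lra.
set s := #|S| in gmul gMul *.
pose rho : R := n%:R / s.+1%:R.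
have s0 : 0 < s.+1%:R :> R by [].
have rho_gmin : (gap_min S)%:R <= rho.
  by rewrite /rho ler_pdivlMr// -natrM ler_nat; lia.
have rho_gmax : rho <= 2 * (gap_max S)%:R.
  rewrite /rho ler_pdivrMr// -!natrM ler_nat.
  have : (n <= 2 * (n.+1 - k))%N by nia.
  by nia.
have g3 : 3 <= (gap_min S)%:R :> R by rewrite (ler_nat _ 3); lia.
have rho3 : 3 <= rho by lra.
have rho0 : 0 < rho by lra.
have lnrho : 2 / 3 <= ln rho.
  have := ln_lower rho0; have : rho^-1 <= 3^-1 by rewrite lef_pV2 ?posrE//; lra.
  lra.
have lnn : 0 < ln n%:R :> R by rewrite ln_gt0.
have remE : remainder_order R n s = rho^-1 * ln rho * ln n%:R.
  by rewrite /remainder_order /rho invf_div.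
have r0 : 0 < remainder_order R n s.
  have lr : 0 < ln rho by lra.
  by rewrite remE !mulr_gt0// invr_gt0.
split => //.
have [L /andP[L1 L2]] := dyadic_radius k0 kg.
pose D : R := (k * 4 ^ L)%:R.
have D0 : 0 < D by rewrite ltr0n muln_gt0 k0 expn_gt0.
have D1 : 3 * D <= (gap_min S)%:R by rewrite /D -natrM ler_nat.
have D2 : (gap_min S)%:R <= 12 * D by rewrite /D -natrM ler_nat ltnW.
have cal0 : 0 < calibration k kappa by rewrite mulr_gt0// exprn_gt0//; lra.
have lam0 : 0 < lambda by rewrite mulr_gt0// lambda_order_gt0.
set K := (2 * k - 1)%N.
have lamsq : (n%:R * lambda) ^+ 2 = calibration k kappa ^+ 2 * (rho ^+ K * ln n%:R).
  by rewrite /lambda mulrCA exprMn lambda_order_sq.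
have calsq : 16 * (2 * kappa) ^+ K <= calibration k kappa ^+ 2.
  rewrite [leRHS]exprMn -[in leRHS]exprM (_ : 4 ^+ 2 = 16 :> R); last by rewrite expr2 -natrM.
  have K2 : (K <= k * 2)%N by rewrite /K mulnC leq_subr.
  exact: (ler_wpM2l _ (ler_weXn2l kappa2 K2)).
have rhoK : 0 < rho ^+ K by exact: exprn_gt0.
have cmax : 4 * ln n%:R * (gap_max S)%:R ^+ (2 * k - 1) <= (n%:R * lambda) ^+ 2.
  have h : (gap_max S)%:R ^+ K <= (2 * kappa * rho) ^+ K.
    rewrite lerXn2r ?nnegrE//; first by rewrite !mulr_ge0// ltW.
    by rewrite (le_trans gkappa)//; nra.
  rewrite lamsq -/K; move: h calsq; rewrite exprMn.
  have : 0 <= (2 * kappa) ^+ K by rewrite exprn_ge0.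
  set a := (2 * kappa) ^+ K; set b := calibration k kappa ^+ 2.
  set m := (gap_max S)%:R ^+ K; set l := ln n%:R => a0 h1 h2.
  have := ler_wpM2r (ltW rhoK) h2; have : 0 <= l by exact: ltW.
  move: (rho ^+ K) rhoK h1 => z z0 h1 l0 h3.
  apply: (@le_trans _ _ (l * (16 * a * z))).
    have laz := mulr_ge0 l0 (mulr_ge0 a0 (ltW z0)).
    have := ler_wpM2l l0 h1; clear -laz; nra.
  have -> : b * (z * l) = l * (b * z) by ring.
  exact: ler_wpM2l.
have cmin : 4 * (4 * ln n%:R) * (4 * k * 4 ^ L)%:R ^+ (2 * k - 1) <= (n%:R * lambda) ^+ 2.
  have h : (4 * k * 4 ^ L)%:R ^+ K <= (2 * kappa * rho) ^+ K.
    rewrite -mulnA natrM -/D lerXn2r ?nnegrE//.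
    - by rewrite mulr_ge0// ltW.
    - by rewrite !mulr_ge0// ltW.
    - nra.
  rewrite lamsq -/K; move: h calsq; rewrite exprMn.
  have : 0 <= (2 * kappa) ^+ K by rewrite exprn_ge0.
  set a := (2 * kappa) ^+ K; set b := calibration k kappa ^+ 2.
  set m := (4 * k * 4 ^ L)%:R ^+ K; set l := ln n%:R => a0 h1 h2.
  have := ler_wpM2r (ltW rhoK) h2; have : 0 <= l by exact: ltW.
  move: (rho ^+ K) rhoK h1 => z z0 h1 l0 h3.
  apply: (@le_trans _ _ (l * (16 * a * z))).
    have laz := mulr_ge0 l0 (mulr_ge0 a0 (ltW z0)).
    have := ler_wpM2l l0 h1; clear -laz; nra.
  have -> : b * (z * l) = l * (b * z) by ring.
  exact: ler_wpM2l.
have c0 : 0 <= 4 * ln n%:R :> R by rewrite mulr_ge0// ltW.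
have [V hV] := fast_rate kn L1 lam0 c0 cmax cmin.
exists V => y f0 f yV; apply: (le_trans (hV y f0 f yV)); rewrite lerD2l.
have -> : 4 * n%:R * lambda ^+ 2 = 4 / n%:R * (n%:R * lambda) ^+ 2.
  by field; rewrite gt_eqF.
rewrite lamsq /energy -/K.
have LnL : L.+1%:R <= 3 * ln rho.
  have l4 : 3 / 4 <= ln (4 : R) by have := @ln_lower 4 (ltr0n _ 4); lra.
  have : (L%:R : R) * (3 / 4) <= ln rho.
    apply: (@le_trans _ _ (ln (4 ^+ L))).
      by rewrite lnXn// -[leRHS]mulr_natl ler_wpM2l.
    rewrite ler_ln ?posrE ?exprn_gt0//; apply: le_trans rho_gmin.
    rewrite -natrX ler_nat; apply: leq_trans L1.
    by rewrite mulnA leq_pmull// muln_gt0 k0.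
  by rewrite -natr1; lra.
have E4 : rho ^+ K / 4 ^+ (K * L) <= (24 * k%:R * kappa) ^+ K.
  rewrite mulnC exprM -expr_div_n lerXn2r ?nnegrE//.
  - by rewrite divr_ge0 ?exprn_ge0// ltW.
  - by rewrite !mulr_ge0// ltW.
  rewrite ler_pdivrMr ?exprn_gt0//.
  have -> : 24 * k%:R * kappa * 4 ^+ L = 2 * (kappa * (12 * D)).
    by rewrite /D natrM natrX; ring.
  apply: (le_trans rho_gmax); rewrite ler_wpM2l// (le_trans gkappa)//.
  by rewrite ler_wpM2l//; lra.
rewrite remE.
have -> : 4 / n%:R * (4 * ln n%:R * (k * s.+1)%:R) = 16 * k%:R * rho^-1 * ln n%:R.
  by rewrite /rho invf_div natrM; ring.
have sn : s%:R / n%:R <= rho^-1.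
  by rewrite /rho invf_div ler_wpM2r ?invr_ge0 ?(ltW n0)// ler_nat.
have -> : 4 / n%:R * (calibration k kappa ^+ 2 * (rho ^+ K * ln n%:R)) *
    (s%:R * (4 ^+ k.+2 * k%:R * L.+1%:R / 4 ^+ (K * L))) =
  4 * calibration k kappa ^+ 2 * (4 ^+ k.+2 * k%:R) * (rho ^+ K / 4 ^+ (K * L)) *
    (s%:R / n%:R) * L.+1%:R * ln n%:R by ring.
rewrite /remainder_constant -/K [X in _ <= X]mulrDl; apply: lerD.
  have -> : 16 * k%:R * rho^-1 = 24 * k%:R * rho^-1 * (2 / 3).
    by field; rewrite gt_eqF.
  rewrite !mulrA ler_wpM2r ?(ltW lnn)// -!(mulrA (24 * k%:R * rho^-1)).
  by rewrite ler_wpM2l// !mulr_ge0// invr_ge0 ltW.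
set A := calibration k kappa ^+ 2; set B := 4 ^+ k.+2 * k%:R.
set C := (24 * k%:R * kappa) ^+ K in E4 *.
have A0 : 0 <= A by exact: sqr_ge0.
have B0 : 0 <= B by rewrite /B mulr_ge0 ?exprn_ge0.
have X0 : 0 <= 4 * A * B by rewrite mulr_ge0// mulr_ge0.
have -> : 12 * A * C * B * (rho^-1 * ln rho * ln n%:R) =
    4 * A * B * (C * rho^-1 * (3 * ln rho)) * ln n%:R by ring.
rewrite ler_wpM2r ?(ltW lnn)// -!(mulrA (4 * A * B)) ler_wpM2l//.
have EE0 : 0 <= rho ^+ K / 4 ^+ (K * L) by rewrite divr_ge0 ?exprn_ge0// ltW.
have sn0 : 0 <= s%:R / n%:R :> R by rewrite divr_ge0.
exact: (ler_pM (mulr_ge0 EE0 sn0) (ler0n _ _) (ler_pM EE0 sn0 E4 sn) LnL).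
Qed.

End calibration.

(** * Asymptotic bookkeeping *)

Section asymptotics.
Context {R : realType}.

Lemma bigO_seq_bound (a b : nat -> R) : bigO_seq a b ->
  exists (C : R) (N : nat), forall n, (N <= n)%N -> a n / b n <= C.
Proof.
rewrite /bigO_seq /limn_esup /limf_esup => /ereal_inf_lt[_ [A [N _ NA] <-] supA].
have ub n : (N <= n)%N -> ((a n / b n)%:E <= ereal_sup ((fun n => (a n / b n)%:E) @` A))%E.
  by move=> nN; apply: ereal_sup_ubound; exists n => //; exact: NA.
move: supA ub; case: (ereal_sup _) => [c||] //= _ ub.
  by exists c, N => n /ub; rewrite lee_fin.
by exists 0, N => n /ub.
Qed.

Lemma bound_bigO_seq (a b : nat -> R) (C : R) (N : nat) :
  (forall n, (N <= n)%N -> a n / b n <= C) -> bigO_seq a b.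
Proof.
move=> h; apply: (@le_lt_trans _ _ C%:E); last exact: ltry.
apply: (@le_trans _ _ (ereal_sup ((fun n => (a n / b n)%:E) @` [set n | (N <= n)%N]))).
  by apply: ereal_inf_lbound; exists [set n | (N <= n)%N] => //; exists N.
by apply: ge_ereal_sup => _ [n /= Nn <-]; rewrite lee_fin h.
Qed.

Lemma limn_esup_le_over (u : nat -> \bar R) (C : R) (N : nat) :
  (forall n, (0 <= u n)%E) ->
  (forall n, (N <= n)%N -> (u n <= (C / n%:R)%:E)%E) -> limn_esup u = 0%E.
Proof.
move=> u0 uC; apply/eqP; rewrite eq_le; apply/andP; split; last first.
  rewrite limn_esup_lim; apply: lime_ge; first exact: is_cvg_esups.
  apply: nearW => n; apply: (le_trans (u0 n)).
  by apply: ereal_sup_ubound; exists n => /=.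
apply/lee_addgt0Pr => e e0; rewrite add0e.
pose A := [set n | (maxn N (Num.truncn (`|C| / e)).+1 <= n)%N].
apply: (@le_trans _ _ (ereal_sup (u @` A))).
  by apply: ereal_inf_lbound; exists A => //; exists (maxn N (Num.truncn (`|C| / e)).+1).
apply: ge_ereal_sup => _ [n /= nA <-].
have /andP[nN nC] : (N <= n)%N && ((Num.truncn (`|C| / e)).+1 <= n)%N by rewrite -geq_max.
apply: (le_trans (uC n nN)); rewrite lee_fin.
have n0 : 0 < n%:R :> R by rewrite ltr0n (leq_trans _ nC).
rewrite ler_pdivrMr// (le_trans (ler_norm C))// mulrC -ler_pdivrMr//.
apply/ltW/(lt_le_trans (truncnS_gt _)); first by rewrite ler_nat.
Qed.

(** Beyond the level C, the tail probabilities are O(1/n), so their upper limit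
    is 0. *)
Lemma bounded_in_probability_of_bad (d : nat -> measure_display)
    (T : forall n, measurableType (d n)) (P : forall n, probability (T n) R)
    (Z : forall n, T n -> R) (C C' : R) (N : nat) :
  (forall n, measurable_fun setT (Z n)) ->
  (forall n, (N <= n)%N -> exists bad : set (T n),
     [/\ measurable bad, (P n bad <= (C' / n%:R)%:E)%E &
         forall w, ~ bad w -> `|Z n w| <= C]) ->
  bounded_in_probability P Z.
Proof.
move=> mZ hbad; rewrite /bounded_in_probability.
apply: cvg_near_cst; near=> M.
have CM : C <= M by near: M; apply: nbhs_pinfty_ge; rewrite num_real.
apply: (@limn_esup_le_over _ C' N) => [n|n Nn]; first exact: measure_ge0.
have [bad [mbad Pbad Zbad]] := hbad n Nn.
apply: le_trans Pbad; apply: le_measure; rewrite ?inE//.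
- rewrite -[X in measurable X]setTI; rewrite (_ : [set w | _] =
    (fun w => `|Z n w|) @^-1` `]M, +oo[%classic).
    by apply: measurableT_comp.
  by apply/seteqP; split => w /=; rewrite in_itv/= andbT.
- move=> w /= MZ; apply: contrapT => nb; move: (Zbad w nb) MZ; lra.
Unshelve. all: by end_near. Qed.

End asymptotics.

(** * The remainder and the theorem *)

Section assembly.
Context {R : realType}.

(** The level 4 ln n gives each of the at most 2n forms probability
    2 n^-2. *)
Lemma gaussian_event_bound (n k : nat) : (0 < n)%N ->
  (n - k + n)%:R * (2 * expR (- (4 * ln n%:R / 2))) <= 4 / n%:R :> R.
Proof.
move=> n0; have nR : 0 < n%:R :> R by rewrite ltr0n.
have -> : expR (- (4 * ln n%:R / 2)) = (n%:R ^+ 2)^-1 :> R.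
  rewrite (_ : 4 * ln n%:R / 2 = ln (n%:R ^+ 2)); last by rewrite lnXn//; field.
  by rewrite expRN lnK// posrE exprn_gt0.
rewrite ler_pdivlMr//.
have -> : (n - k + n)%:R * (2 * (n%:R ^+ 2)^-1) * n%:R = 2 * ((n - k + n)%:R / n%:R) :> R.
  by field; rewrite gt_eqF.
have : (n - k + n)%:R / n%:R <= 2 :> R.
  by rewrite ler_pdivrMr// -natrM ler_nat; lia.
lra.
Qed.

(** The remainder is the deterministic bound, plus the crude bound on the
    exceptional event.  When the hypotheses of the second part fail, the crude
    bound alone serves. *)
Lemma remainder_variable (k n : nat) (f0 f : 'cV[R]_n) (d : measure_display)
    (T : measurableType d) (P : probability T R) (Y : 'I_n -> {RV P >-> R})
    (S : {set 'I_(n - k)}) (kappa : R) :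
  let lambda := calibration k kappa * lambda_order R k n #|S| in
  let r := remainder_order R n #|S| in
  0 <= lambda ->
  exists Rem : {RV P >-> R},
    (forall w, sqnorm_n (estimator k lambda (observation Y w) - f0) <=
       sqnorm_n (f - f0) + 4 * lambda * norm1_off S f + Rem w) /\
    ((0 < k <= n)%N -> (3 * k <= gap_min S)%N -> 1 <= kappa ->
     (gap_max S)%:R <= kappa * (gap_min S)%:R -> std_gaussian_vector Y f0 ->
     exists bad : set T, [/\ measurable bad, (P bad <= (4 / n%:R)%:E)%E &
        forall w, ~ bad w -> `|Rem w / r| <= remainder_constant k kappa]).
Proof.
move=> lambda r l0.
pose crude w := 4 * sqnorm_n (observation Y w - f0) + 4 * lambda * norm1 (Delta R k n *m f0).
have crude0 w : 0 <= crude w.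
  by rewrite addr_ge0// mulr_ge0 ?sqnorm_n_ge0 ?norm1_ge0// mulr_ge0.
have mY i : measurable_fun setT (Y i) by exact: measurable_funP.
have mcrude : measurable_fun setT crude.
  apply: measurable_funD => //; apply: measurable_funM => //.
  apply: measurable_funM => //; apply: measurable_sum => i.
  rewrite (_ : (fun w => _) = (fun w => (Y i w - f0 i 0) ^+ 2)).
    by apply: measurable_funX => //; apply: measurable_funB.
  by apply/funext => w; rewrite !mxE.
have hcrude w : sqnorm_n (estimator k lambda (observation Y w) - f0) <=
    sqnorm_n (f - f0) + 4 * lambda * norm1_off S f + crude w.
  apply: le_trans (crude_bound k _ f0 l0) _; rewrite lerDr addr_ge0 ?sqnorm_n_ge0//.
  by rewrite mulr_ge0 ?(mulr_ge0 _ l0)//; apply: sumr_ge0.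
have [hyp|nhyp] := pselect [/\ (0 < k <= n)%N, (3 * k <= gap_min S)%N, 1 <= kappa,
   (gap_max S)%:R <= kappa * (gap_min S)%:R & std_gaussian_vector Y f0]; last first.
  have mcrude' := isMeasurableFun.Build _ _ _ _ crude mcrude.
  pose Rem : {RV P >-> R} := HB.pack crude mcrude'.
  by exists Rem; split => // h1 h2 h3 h4 h5; exfalso; apply: nhyp.
have [kn kg kappa1 gk gY] := hyp.
have [r0 [V hV]] := fast_rate_calibrated kn kg kappa1 gk.
have n3 : (2 < n)%N.
  have := gap_min_mul S ltac:(lia); lia.
have c0 : 0 < 4 * ln n%:R :> R by rewrite mulr_gt0// ln_gt0// ltr1n; lia.
have [+ +] := @gaussian_sq_union_bound R d T P n (n - k + n) Y f0 V (4 * ln n%:R) gY c0.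
set bad := \big[setU/set0]_(j < _) _ => mbad Pbad.
pose rem w := remainder_constant k kappa * r + crude w * \1_bad w.
have mrem : measurable_fun setT rem.
  by apply: measurable_funD => //; apply: measurable_funM.
have mrem' := isMeasurableFun.Build _ _ _ _ rem mrem.
pose Rem : {RV P >-> R} := HB.pack rem mrem'.
have C0 : 0 <= remainder_constant k kappa.
  have kap0 : 0 <= kappa by lra.
  have kap24 : 0 <= 24 * k%:R * kappa by rewrite mulr_ge0// mulr_ge0.
  have pow4 : 0 <= 4 ^+ k.+2 * k%:R :> R by rewrite mulr_ge0 ?exprn_ge0.
  have k24 : 0 <= 24 * k%:R :> R by rewrite mulr_ge0.
  have cal2 : 0 <= 12 * calibration k kappa ^+ 2 by rewrite mulr_ge0 ?sqr_ge0.
  exact: (addr_ge0 k24 (mulr_ge0 (mulr_ge0 cal2 (exprn_ge0 _ kap24)) pow4)).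
exists Rem; split => [w|_ _ _ _ _].
  rewrite /= /rem; have [wbad|wbad] := pselect (bad w).
    apply: (le_trans (hcrude w)); rewrite lerD2l indicE mem_set// mulr1.
    by rewrite lerDr mulr_ge0// ltW.
  rewrite indicE memNset// mulr0 addr0; apply: hV => j.
  rewrite leNgt; apply/negP => hj; apply: wbad.
  rewrite /bad (bigD1 j)//=; left => /=.
  by move: hj; under [X in _ < X ^+ 2 -> _]eq_bigr do rewrite mxE.
exists bad; split => //.
  apply: (le_trans Pbad); rewrite lee_fin; apply: gaussian_event_bound; lia.
move=> w wbad; rewrite /= /rem indicE memNset// mulr0 addr0 mulfK ?gt_eqF//.
by rewrite ger0_norm.
Qed.

End assembly.

(* The sequences are considered for n >= n0; their values below n0 are
   unconstrained. *)
Theorem corollary1p2 (R : realType) (k : nat) (hk : (1 <= k <= 4)%N)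
  (n0 : nat)
  (f0 : forall n : nat, 'cV[R]_n)
  (d : nat -> measure_display)
  (T : forall n : nat, measurableType (d n))
  (P : forall n : nat, probability (T n) R)
  (Y : forall n : nat, 'I_n -> {RV (P n) >-> R})
  (hY : forall n : nat, (n0 <= n)%N -> std_gaussian_vector (Y n) (f0 n))
  (S : forall n : nat, {set 'I_(n - k)})
  (hS_asymp : asymp (fun n => (gap_min (S n))%:R : R)
                    (fun n => (gap_max (S n))%:R : R))
  (hS_gap : forall n : nat, (n0 <= n)%N ->
     forall i : nat, (1 <= i <= #|S n|.+1)%N ->
       (k * (k + 2) <= gap (S n) i)%N) :
  exists lambda : nat -> R,
    [/\ forall n : nat, (n0 <= n)%N -> 0 < lambda n,
        asymp lambda (fun n => lambda_order R k n #|S n|) &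
        forall f : (forall n : nat, 'cV[R]_n),
          exists Rem : forall n : nat, {RV (P n) >-> R},
            bounded_in_probability P
              (fun n w => Rem n w / remainder_order R n #|S n|) /\
            forall (n : nat) (w : T n), (n0 <= n)%N ->
              sqnorm_n (estimator k (lambda n) (observation (Y n) w) - f0 n)
                <= sqnorm_n (f n - f0 n)
                   + 4 * lambda n * norm1_off (S n) (f n)
                   + Rem n w].
Proof.
have k0 : (0 < k)%N by case/andP: hk.
have kn n : (n0 <= n)%N -> (k <= n)%N.
  move=> /hS_gap/(_ 1%N isT); rewrite leqNgt => h; apply/negP => nk.
  have S0 : #|S n| = 0%N.
    by apply/eqP; rewrite cards_eq0; apply/eqP/setP => -[i hi]; exfalso; lia.
  by move: h; rewrite /gap (_ : 1%N = #|S n|.+1) ?knot_last ?S0//=; nia.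
have kg n : (n0 <= n)%N -> (3 * k <= gap_min (S n))%N.
  by move=> hn; apply: le_gap_min => i hi; have := hS_gap n hn i hi; nia.
have n1 n : (n0 <= n)%N -> (1 < n)%N.
  by move=> hn; have := kg n hn; have := gap_min_mul (S n) (kn n hn); nia.
have [kappa [N kappa1 hkappa]] : exists kappa : R, exists2 N : nat, 1 <= kappa &
    forall n, (N <= n)%N -> (n0 <= n)%N ->
      (gap_max (S n))%:R <= kappa * (gap_min (S n))%:R.
  have [C [N hC]] := bigO_seq_bound hS_asymp.2.
  exists (Num.max C 1), N; first by rewrite le_max lexx orbT.
  move=> n Nn hn; have g0 : 0 < (gap_min (S n))%:R :> R.
    by rewrite ltr0n; have := kg n hn; lia.
  rewrite -ler_pdivrMr//; apply: (le_trans (hC n Nn)).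
  by rewrite le_max lexx.
have cal0 : 0 < calibration k kappa by rewrite mulr_gt0 ?exprn_gt0//; lra.
pose lambda n := calibration k kappa * lambda_order R k n #|S n|.
have lo0 n : (1 < n)%N -> 0 < lambda_order R k n #|S n| by exact: lambda_order_gt0.
have l0 n : 0 <= lambda n.
  apply: mulr_ge0; first exact: ltW.
  apply: mulr_ge0; last exact: sqrtr_ge0.
  by rewrite mulr_ge0 ?exprn_ge0 ?powR_ge0.
exists lambda; split.
- by move=> n /n1 hn; rewrite mulr_gt0// lo0.
- split.
    apply: (@bound_bigO_seq _ _ _ (calibration k kappa) 2) => n hn.
    by rewrite /lambda mulfK// gt_eqF// lo0.
  apply: (@bound_bigO_seq _ _ _ (calibration k kappa)^-1 2) => n hn.
  by rewrite /lambda invfM mulrCA divff ?mulr1// gt_eqF// lo0.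
move=> f.
have /(_ _)/cid-/all_sig[Rem hRem] := fun n =>
  @remainder_variable R k n (f0 n) (f n) (d n) (T n) (P n) (Y n) (S n) kappa (l0 n).
exists Rem; split; last by move=> n w _; have [+ _] := hRem n; exact.
apply: (@bounded_in_probability_of_bad R d T P _ (remainder_constant k kappa) 4 (maxn N n0)).
  move=> n; apply: measurable_funM => //; exact: measurable_funP.
move=> n; rewrite geq_max => /andP[Nn hn]; have [_ +] := hRem n.
apply=> //; first by rewrite k0 kn.
- exact: kg.
- exact: hkappa.
- exact: hY.
Qed.
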